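(* For every $0<\varepsilon<1$ there exists a constant $C>0$ such that the following holds. Let $p=p(n)\in(0,1)$ and $k=k(n)$ with $2\le k\le n/2$, and put $N=\binom{n}{k}$ and $D=\binom{n-k}{k}$. Then, asymptotically almost surely as $n\to\infty$: (1) if $N^{-1}\ll p\ll D^{-1}$, then $i(\mathcal{H}^k(n,p))=(1\pm\varepsilon)pN$; (2) if $D^{-1}\ll p\le (n/k)D^{-1}$ and $k\gg\sqrt{n\ln n}$, then $i(\mathcal{H}^k(n,p))\ge(1-\varepsilon)\frac{N}{D}\ln(pD)$; (3) if $D^{-1}\ll p\le (n/k)^{1-\varepsilon}D^{-1}$, then $i(\mathcal{H}^k(n,p))\le C\frac{N}{D}\ln(pD)$; (4) if $p\ge C(n/k)\ln^2(n/k)D^{-1}$, then $i(\mathcal{H}^k(n,p))=(1\pm\varepsilon)p\frac{k}{n}N$.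
   Context: $\mathcal{H}^k(n,p)$ is the binomial random $k$-uniform hypergraph on vertex set $[n]=\{1,\dots,n\}$: each $k$-element subset of $[n]$ is an edge independently with probability $p$. A family of sets is intersecting if every two of its members have nonempty intersection. For a $k$-uniform hypergraph $\mathcal{H}$, $i(\mathcal{H})$ is the maximum number of edges of an intersecting subfamily of $\mathcal{H}$. All asymptotics are as $n\to\infty$; $a(n)\ll b(n)$ means $a(n)/b(n)\to 0$. ''Asymptotically almost surely'' means with probability tending to $1$ as $n\to\infty$. $x=(1\pm\varepsilon)y$ means $(1-\varepsilon)y\le x\le(1+\varepsilon)y$. *)

(* Defs.v *)
From mathcomp Require Import all_boot all_order all_algebra.
From mathcomp Require Import all_classical all_reals all_analysis.
Import Order.TTheory GRing.Theory Num.Theory.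
Import numFieldNormedType.Exports.
Set Implicit Arguments.
Unset Strict Implicit.
Unset Printing Implicit Defensive.
Local Open Scope ring_scope.

(* A hypergraph on the vertex set [n] is identified with its set of edges;
   [n] is represented by 'I_n. *)
Notation hypergraph n := {set {set 'I_n}}.

Definition ksets (n k : nat) : hypergraph n := [set e : {set 'I_n} | #|e| == k].

Definition intersecting (n : nat) (F : hypergraph n) : bool :=
  [forall A in F, forall B in F, A :&: B != finset.set0].

Definition max_intersecting (n : nat) (H : hypergraph n) : nat :=
  (\max_(F : hypergraph n | (F \subset H) && intersecting F) #|F|)%N.

(* The binomial random hypergraph H^k(n,p) as a finite probability space: the
   outcomes are the k-uniform hypergraphs on 'I_n, weighted by the product of
   the independent Bernoulli(p) edge indicators. *)
Definition hyp_weight (R : realType) (n k : nat) (p : R) (H : hypergraph n) : R :=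
  \prod_(e in ksets n k) (if e \in H then p else 1 - p).

Definition hyp_prob (R : realType) (n k : nat) (p : R)
    (E : hypergraph n -> bool) : R :=
  \sum_(H : hypergraph n | (H \subset ksets n k) && E H) hyp_weight k p H.

Local Open Scope classical_set_scope.

Definition aas (R : realType) (k : nat -> nat) (p : nat -> R)
    (E : forall n : nat, hypergraph n -> bool) : Prop :=
  hyp_prob (k n) (p n) (E n) @[n --> \oo] --> (1 : R).

(* a(n) << b(n) *)
Definition much_less (R : realType) (a b : nat -> R) : Prop :=
  a n / b n @[n --> \oo] --> (0 : R).

(* x = (1 +- eps) y *)
Definition approx_eq (R : realType) (eps x y : R) : bool :=
  (1 - eps) * y <= x <= (1 + eps) * y.

(* Main.v *)
(** The k-sets form the vertices of the Kneser graph (edges = disjoint pairs), so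
    intersecting families are its independent sets.

    Upper bounds.  Katona's cycle argument, applied quantitatively and averaged
    over all cyclic orders, shows that [a N] vertices span at least
    [N D a (a n - k) / (n - k)] ordered disjoint pairs, the same bound as Hoffman's.
    Hence the Kleitman-Winston algorithm puts every independent set, up to a
    fingerprint of [s] vertices, into a container of size at most
    [N (k/n + (1 - D/N)^s)] determined by the fingerprint; a union bound over the
    fingerprints together with a Chernoff bound inside each container gives the
    upper bounds in (3) and (4).

    Lower bounds.  In (1) delete every edge that is disjoint from another one; in
    (4) take a star.  In (2) the random subgraph has average degree about [p D] and
    [k >> sqrt (n ln n)] makes its triangles negligible, so Shearer's
    independence bound for triangle-free graphs applies. *)

Require Import Defs.
From mathcomp Require Import all_boot all_order all_algebra all_fingroup.
From mathcomp Require Import zify ring lra.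
From mathcomp Require Import reals sequences exp.
Import Order.TTheory GRing.Theory Num.Theory.
Set Implicit Arguments.
Unset Strict Implicit.
Unset Printing Implicit Defensive.
Local Open Scope ring_scope.

(** Write [Q = N/D], [r = n/k] and [y = p D]. The union bound over fingerprints of size [s] costs
    [exp(Q + s ln y)], while about [Q ln z] fingerprint vertices are needed before the container
    shrinks to [N (1/r + 1/z)]. This price explains the ranges of [p] in the upper bounds. A star
    has about [Q y / r] random edges; with [z] of order [r] the price [Q ln r ln y] stays below it
    once [y] exceeds a large multiple of [r ln^2 r], which gives (4). In (3) the container is
    expected to hold at most about [Q y^(-eps)] random edges, so each further edge gains a factor of
    about [y^eps], and [C Q ln y] of them outweigh a price of order [Q ln^2 y]. In (2) the leading
    constant must be 1, so the solution of Shearer's differential inequality has to be sharp at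
    infinity yet valid from 0 on; stretching a fixed convex function by a large factor [u] loses
    only a factor [1 - O(1/u)]. Every tail estimate is explicit for each admissible [n]; limits
    enter only at the end. *)

Lemma eq_ler (R : numDomainType) (x y : R) : x = y -> x <= y.
Proof. by move=> ->. Qed.

(** * Bernoulli random subsets *)

Section BernoulliSubset.
Variables (R : realFieldType) (V : finType) (K : {set V}) (p : R).

(** The ground set [K] is arbitrary; for [K = ksets n k] the weight is [hyp_weight] by conversion,
    so the bounds below apply to [hyp_prob] directly. *)
Definition bwt (H : {set V}) : R :=
  \prod_(e in K) (if e \in H then p else 1 - p).

Definition expect (f : {set V} -> R) : R :=
  \sum_(H : {set V} | H \subset K) bwt H * f H.

Lemma expect_prod (g h : V -> R) :
  expect (fun H => \prod_(e in K) (if e \in H then g e else h e)) =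
  \prod_(e in K) (p * g e + (1 - p) * h e).
Proof.
rewrite [RHS]big_mkcond /=.
(* Outside [K] the summand for membership is 0, so distributing the product over the sums leaves
   exactly the subsets of [K]. *)
rewrite (eq_bigr (fun i => (if i \in K then p * g i else 0)
   + (if i \in K then (1 - p) * h i else 1))); last first.
  by move=> i _; case: ifP => // _; rewrite add0r.
rewrite bigA_distr /expect big_mkcond /=; apply: eq_bigr => H _.
case: ifP => [sHK|/negbT].
  rewrite /bwt -big_split /= big_mkcond /=; apply: eq_bigr => e _.
  case: (boolP (e \in K)) => eK; case: (boolP (e \in H)) => eH //.
  by rewrite (subsetP sHK _ eH) in eK.
by case/subsetPn => e eH eK; rewrite (bigD1 e) //= eH (negbTE eK) mul0r.
Qed.

Lemma expectD f g : expect (fun H => f H + g H) = expect f + expect g.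
Proof. by rewrite -big_split; apply: eq_bigr => H _; rewrite mulrDr. Qed.

Lemma expectZ c f : expect (fun H => c * f H) = c * expect f.
Proof. by rewrite big_distrr; apply: eq_bigr => H _; rewrite mulrCA. Qed.

Lemma expect_sum (I : finType) (P : pred I) (F : I -> {set V} -> R) :
  expect (fun H => \sum_(i | P i) F i H) = \sum_(i | P i) expect (F i).
Proof. by rewrite exchange_big; apply: eq_bigr => H _; rewrite mulr_sumr. Qed.

Lemma eq_expect (f g : {set V} -> R) :
  (forall H : {set V}, H \subset K -> f H = g H) -> expect f = expect g.
Proof. by move=> fg; apply: eq_bigr => H sHK; rewrite fg. Qed.

(** Indicator and power are both products over the edges, and disjointness keeps their factors
    apart. In the container bound [T] is a fingerprint and [C] the rest of its container; [x = 0]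
    gives inclusion probabilities. *)
Lemma expect_incl_mgf (T C : {set V}) (x : R) :
  T \subset K -> C \subset K -> [disjoint T & C] ->
  expect (fun H => (T \subset H)%:R * (1 + x) ^+ #|H :&: C|) =
  p ^+ #|T| * (1 + p * x) ^+ #|C|.
Proof.
move=> sTK sCK dTC.
have notC e : e \in T -> e \in C = false by move=> eT; rewrite (disjointFr dTC).
rewrite (eq_expect (g := fun H => \prod_(e in K)
  (if e \in H then (if e \in C then 1 + x else 1)
   else (if e \in T then 0 else 1)))); last first.
  move=> H sHK; case: (boolP (T \subset H)) => [sTH|/subsetPn[e eT eH]]; last first.
    by rewrite mul0r (bigD1 e) ?(subsetP sTK) //= (negbTE eH) eT mul0r.
  rewrite mul1r -prodr_const big_mkcond [RHS]big_mkcond /=; apply: eq_bigr => e _.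
  rewrite inE; case: (boolP (e \in H)) => eH /=.
    by rewrite (subsetP sHK _ eH).
  by case: ifP => // _; case: (boolP (e \in T)) => // /(subsetP sTH); rewrite (negbTE eH).
rewrite expect_prod -!prodr_const big_mkcond [X in X * _]big_mkcond.
rewrite [X in _ * X]big_mkcond -big_split /=; apply: eq_bigr => e _.
have [eT|eT] := boolP (e \in T).
  by rewrite (notC _ eT) (subsetP sTK _ eT); ring.
have [eC|eC] := boolP (e \in C).
  by rewrite (subsetP sCK _ eC); ring.
by case: ifP => _; ring.
Qed.

Lemma expect_incl (T : {set V}) :
  T \subset K -> expect (fun H => (T \subset H)%:R) = p ^+ #|T|.
Proof.
move=> sTK; have := @expect_incl_mgf T set0 0 sTK (sub0set _).
rewrite mulr0 addr0 expr1n mulr1 => <-.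
  by apply: eq_expect => H _; rewrite expr1n mulr1.
by rewrite disjoint_sym disjoints_subset sub0set.
Qed.

Lemma expect_cst c : expect (fun=> c) = c.
Proof.
rewrite -[RHS]mulr1 -(expr0 p) -(cards0 V) -expect_incl ?sub0set // -expectZ.
by apply: eq_expect => H _; rewrite sub0set mulr1.
Qed.

Lemma cardI_sum (H C : {set V}) :
  #|H :&: C|%:R = \sum_(e in C) (e \in H)%:R :> R.
Proof.
rewrite -sum1_card natr_sum big_mkcond [RHS]big_mkcond; apply: eq_bigr => e _.
by rewrite inE; case: (e \in C); case: (e \in H).
Qed.

Lemma inclM (T : {set V}) (H : {set V}) (e : V) :
  (T \subset H)%:R * (e \in H)%:R = (e |: T \subset H)%:R :> R.
Proof. by rewrite subUset sub1set -natrM mulnb andbC. Qed.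

Hypothesis p01 : 0 <= p <= 1.

Lemma bwt_ge0 H : 0 <= bwt H.
Proof.
by apply: prodr_ge0 => e _; case: ifP => _; case/andP: p01 => p0 p1; rewrite ?subr_ge0.
Qed.

Lemma ler_expect (f g : {set V} -> R) :
  (forall H : {set V}, H \subset K -> f H <= g H) -> expect f <= expect g.
Proof. by move=> fg; apply: ler_sum => H sHK; rewrite ler_wpM2l ?bwt_ge0 ?fg. Qed.

(** As [T] and [C] are disjoint, the presence of [T] is independent of the binomial [#|H :&: C|],
    whose variance is at most its mean. The empty [T] gives the variance itself; [T = [set A]] with
    [C] the neighbours of [A] measures the degree deviation of a present edge. *)
Lemma expect_incl_variance (T C : {set V}) :
  T \subset K -> C \subset K -> [disjoint T & C] ->
  expect (fun H => (T \subset H)%:R * (#|H :&: C|%:R - p * #|C|%:R) ^+ 2) <=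
  p ^+ #|T| * (p * #|C|%:R).
Proof.
move=> sTK sCK dTC; set c : R := #|C|%:R; set t := #|T|.
have [p0 p1] := andP p01.
have nT e : e \in C -> e \notin T by move=> eC; rewrite (disjointFl dTC).
have sub1 e : e \in C -> e |: T \subset K.
  by move=> eC; rewrite subUset sub1set (subsetP sCK) ?sTK.
have E1 : expect (fun H => (T \subset H)%:R * #|H :&: C|%:R) = c * p ^+ t.+1.
  rewrite (eq_expect (g := fun H => \sum_(e in C) (e |: T \subset H)%:R)); last first.
    by move=> H _; rewrite cardI_sum mulr_sumr; apply: eq_bigr => e _; rewrite inclM.
  rewrite expect_sum (eq_bigr (fun=> p ^+ t.+1)) => [|e eC].
    by rewrite sumr_const mulr_natl.
  by rewrite expect_incl ?sub1 // cardsU1 nT.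
have E2 : expect (fun H => (T \subset H)%:R * #|H :&: C|%:R ^+ 2) <=
          c * p ^+ t.+1 + c ^+ 2 * p ^+ t.+2.
  rewrite (eq_expect (g := fun H =>
      \sum_(e in C) \sum_(f in C) (f |: (e |: T) \subset H)%:R)); last first.
    move=> H _; rewrite cardI_sum expr2 mulrA [X in X * _]mulr_sumr mulr_suml.
    apply: eq_bigr => e _; rewrite mulr_sumr; apply: eq_bigr => f _.
    by rewrite !inclM.
  rewrite expect_sum.
  have -> : c * p ^+ t.+1 + c ^+ 2 * p ^+ t.+2 =
      \sum_(e in C) (p ^+ t.+1 + \sum_(f in C) p ^+ t.+2).
    by rewrite sumr_const sumr_const -mulr_natl -/c -[_ *+ #|C|]mulr_natl -/c;
      clear E1; move: c t => c0 t0; ring.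
  apply: ler_sum => e eC; rewrite expect_sum (bigD1 e) //=.
  rewrite [\sum_(f in C) _](bigD1 e) //= expect_incl; last first.
    by rewrite subUset sub1set (subsetP sCK) ?sub1.
  rewrite setUA setUid cardsU1 nT // addrA lerD //.
    by rewrite lerDl exprn_ge0.
  apply: ler_sum => f /andP[fC nfe]; rewrite expect_incl; last first.
    by rewrite subUset sub1set (subsetP sCK) ?sub1.
  by rewrite !cardsU1 !inE negb_or nfe !nT.
rewrite (eq_expect (g := fun H => (T \subset H)%:R * #|H :&: C|%:R ^+ 2 +
   ((- (2 * (p * c))) * ((T \subset H)%:R * #|H :&: C|%:R)
     + (p * c) ^+ 2 * (T \subset H)%:R))); last first.
  by move=> H _; ring.
rewrite !expectD !expectZ E1 expect_incl // -/t.
apply: le_trans (lerD E2 (lexx _)) _.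
by clear E1 E2; move: c t => c t; apply: eq_ler; rewrite (exprS p t.+1) !(exprS p t); ring.
Qed.

(* Markov's inequality in the form used for every tail bound: [g] dominates the
   indicator of the failure event. *)
Lemma prob_ge_1Bexpect (E : {set V} -> bool) (g : {set V} -> R) :
  (forall H : {set V}, H \subset K -> 0 <= g H) ->
  (forall H : {set V}, H \subset K -> g H < 1 -> E H) ->
  1 - expect g <= \sum_(H : {set V} | (H \subset K) && E H) bwt H.
Proof.
move=> g0 gE; rewrite -[X in X - _](expect_cst 1).
rewrite lerBlDr big_mkcondr -big_split /=; apply: ler_sum => H sHK.
rewrite mulr1; have w0 := bwt_ge0 H.
case: ifP => [_|/negbT nE]; first by rewrite lerDl mulr_ge0 ?g0.
rewrite add0r ler_peMr // leNgt; apply: contra nE; exact: gE.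
Qed.

End BernoulliSubset.

(** * Containers *)

(* Kleitman-Winston algorithm: repeatedly query a vertex of large degree in the
   available set [A]; when it is in [I], put it in the fingerprint and discard
   its neighbours. *)
Lemma container (R : realFieldType) (V : finType) (adj : rel V)
    (K : {set V}) (q kap : R) :
  0 <= q <= 1 -> 0 <= kap ->
  (forall A : {set V}, A \subset K -> A != set0 -> exists2 v, v \in A &
     q * (#|A|%:R - kap) <= #|[set u in A | adj v u]|%:R) ->
  forall (s : nat) (b : R) (A : {set V}),
  A \subset K -> 0 <= b -> #|A|%:R <= kap + b ->
  exists C : {set V} -> {set V},
    (forall T, #|C T|%:R <= kap + b * (1 - q) ^+ s) /\
    (forall I : {set V}, I \subset A -> (s <= #|I|)%N ->
       {in I &, forall u v, ~~ adj u v} ->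
       exists T : {set V}, [/\ T \subset I, #|T| = s & I :\: T \subset C T]).
Proof.
move=> /andP[q0 q1] kap0 dense s b A sAK b0 leA.
have [m] := ubnP #|A|; elim: m => // m IHm in A s b sAK b0 leA *.
rewrite ltnS => leAm.
case: s => [|s].
  exists (fun=> A); split => [_|I sIA _ _]; first by rewrite expr0 mulr1.
  by exists set0; rewrite sub0set cards0 setD0.
have q1s t : 0 <= b * (1 - q) ^+ t by rewrite mulr_ge0 ?exprn_ge0 ?subr_ge0.
have [A0|/(dense _ sAK)[v vA degv]] := eqVneq A set0.
  exists (fun=> set0); split => [_|I]; first by rewrite cards0 addr_ge0.
  by rewrite A0 subset0 => /eqP->; rewrite cards0.
pose A2 := [set u in A :\ v | ~~ adj v u].
have leA1 : (#|A :\ v| < m)%N by move: leAm; rewrite (cardsD1 v) vA.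
have sA21 : A2 \subset A :\ v by apply/subsetP => u; rewrite inE => /andP[].
have leA1b : #|A :\ v|%:R <= kap + b.
  by apply: le_trans leA; rewrite ler_nat subset_leq_card ?subD1set.
(* Removing [q (#|A| - kap)] vertices leaves an excess over [kap] of at most
   [(1 - q) (#|A| - kap)]. *)
have leA2 : #|A2|%:R <= kap + b * (1 - q).
  have : (#|A2| + #|[set u in A | adj v u]| <= #|A|)%N.
    rewrite -cardsUI (_ : A2 :&: _ = set0) ?cards0 ?addn0.
      apply: subset_leq_card; apply/subsetP => u; rewrite !inE.
      by case/orP => /andP[] // /andP[].
    by apply/setP => u; rewrite !inE; case: (adj v u); rewrite ?andbF.
  by rewrite -(ler_nat R) natrD; nra.
have [C1 [C1le C1P]] := IHm (A :\ v) s.+1 b (subset_trans (subD1set _ _) sAK) b0 leA1b leA1.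
have [|C2 [C2le C2P]] := IHm A2 s (b * (1 - q))
   (subset_trans sA21 (subset_trans (subD1set _ _) sAK)) _ leA2
   (leq_ltn_trans (subset_leq_card sA21) leA1).
  by rewrite mulr_ge0 ?subr_ge0.
(* Membership of [v] in [T] reveals the branch taken by the algorithm, so the container is a
   function of the fingerprint alone. When [v] is not in [I], only [v] is lost and [s] stays, hence
   the induction on [#|A|]. *)
exists (fun T : {set V} => if v \in T then C2 (T :\ v) else C1 T); split => [T|I sIA sI indI].
  by case: ifP => // _; rewrite exprS mulrA.
have [vI|vI] := boolP (v \in I); last first.
  have [|T [sTI cT sC]] := C1P I _ sI indI.
    by rewrite subsetD1 sIA.
  by exists T; split; rewrite // (contraNF (subsetP sTI v) vI).
have [|||T [sTI cT sC]] := C2P (I :\ v).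
- apply/subsetP => u; rewrite !inE => /andP[nuv uI].
  by rewrite nuv (subsetP sIA) //= indI.
- by move: sI; rewrite (cardsD1 v I) vI.
- by move=> x y; rewrite !inE => /andP[_ xI] /andP[_ yI]; apply: indI.
have vT : v \notin T by apply/negP => /(subsetP sTI); rewrite !inE eqxx.
exists (v |: T); split.
- by rewrite subUset sub1set vI (subset_trans sTI) ?subD1set.
- by rewrite cardsU1 vT cT.
- by rewrite setU11 setU1K // -setDDl.
Qed.

Lemma exists_ge_average (R : realFieldType) (V : finType) (S : {set V})
    (f : V -> R) (c : R) :
  S != set0 -> #|S|%:R * c <= \sum_(v in S) f v -> exists2 v, v \in S & c <= f v.
Proof.
move=> S0 le_sum; apply/exists_inP; apply: contraLR le_sum => /exists_inPn small.
rewrite -ltNge mulr_natl -sumr_const.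
have [v vS] := set0Pn _ S0.
rewrite (bigD1 v) //= [ltRHS](bigD1 v) //= ltr_leD ?ltNge ?small //.
by apply: ler_sum => u /andP[uS _]; rewrite ltW // ltNge small.
Qed.

(** * Independent sets in triangle-free graphs *)

Section Shearer.
Variables (R : realFieldType) (V : finType) (adj : rel V) (F G : R -> R).
Hypothesis adj_sym : symmetric adj.

Definition degsum (S : {set V}) : R :=
  \sum_(a in S) \sum_(b in S) (adj a b)%:R.

Let deg (S : {set V}) (a : V) : R := \sum_(b in S) (adj a b)%:R.
Let nbr (S : {set V}) (v : V) := [set u in S | adj v u].
Let rest (S : {set V}) (v : V) := [set u in S | (u != v) && ~~ adj v u].

Lemma sum_adj_card S a : deg S a = #|nbr S a|%:R.
Proof.
rewrite /deg -sum1_card natr_sum big_mkcond [RHS]big_mkcond /=.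
by apply: eq_bigr => b _; rewrite inE; case: (b \in S); case: (adj a b).
Qed.

Lemma card_nonnbr (S : {set V}) v : v \in S -> adj v v = false ->
  #|rest S v|%:R = #|S|%:R - deg S v - 1 :> R.
Proof.
move=> vS adj_irr; have -> : #|S| = (#|rest S v| + #|nbr S v| + 1)%N.
  rewrite (cardsD1 v S) vS add1n addn1 -(cardsID (nbr S v) (S :\ v)) [in LHS]addnC.
  congr (_ + _).+1; apply: eq_card => u; rewrite !inE.
    by case: (u \in S); case: (u == v); case: (adj v u).
  case: eqVneq => [->|_] /=; last by case: (u \in S).
  by rewrite adj_irr vS.
by rewrite sum_adj_card !natrD; ring.
Qed.

Hypothesis G_le0 : forall x, 0 <= x -> G x <= 0.
Hypothesis tangent : forall x y, 0 <= x -> 0 <= y -> F x + G x * (y - x) <= F y.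
Hypothesis ode : forall x, 0 <= x -> 0 <= 1 - (x + 1) * F x + G x * (x - x ^+ 2).

(* Averaging over [v] the gain from adding [v] and deleting its neighbourhood;
   the differential inequality [ode] says exactly that the average is enough. *)
Lemma shearer (S : {set V}) : {in S, forall v, adj v v = false} ->
  {in S & S & S, forall u v w, adj u v -> adj v w -> ~~ adj u w} ->
  exists I : {set V}, [/\ I \subset S, {in I &, forall u v, ~~ adj u v} &
    forall x, 0 <= x -> #|S|%:R * F x + G x * (degsum S - #|S|%:R * x) <= #|I|%:R].
Proof.
have [m] := ubnP #|S|; elim: m => // m IHm in S *.
rewrite ltnS => leSm irr tfree.
have [->|S0] := eqVneq S set0.
  exists set0; split=> [|u|x x0]; [exact: sub0set|by rewrite inE|].
  by rewrite cards0 /degsum big_set0 !mul0r subrr mulr0 addr0.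
have n0 : 0 < #|S|%:R :> R by rewrite ltr0n card_gt0.
set n : R := #|S|%:R in n0 *.
pose E := degsum S; pose d := E / n.
have Ed : E = n * d by rewrite /d mulrC divfK ?gt_eqF.
have E0 : 0 <= E by do 2!apply: sumr_ge0 => ? _.
have d0 : 0 <= d by rewrite divr_ge0 // ltW.
(* Without triangles, deleting [v] and its neighbours destroys [nd v] edges, so [degsum] falls by
   [2 * nd v]. Then [gain v] is 1 plus the induction bound for what remains, taken at the average
   degree [d]. *)
pose nd v := \sum_(u in nbr S v) deg S u.
pose gain v := 1 + (n - deg S v - 1) * F d
  + G d * (E - 2 * nd v - (n - deg S v - 1) * d).
have sum_nd : \sum_(v in S) nd v = \sum_(u in S) deg S u ^+ 2.
  rewrite (eq_bigr (fun v => \sum_(u in S) (adj v u)%:R * deg S u)); last first.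
    move=> v _; rewrite /nd big_mkcond [RHS]big_mkcond /=; apply: eq_bigr => u _.
    by rewrite inE; case: (u \in S) => //=; case: (adj v u); rewrite ?mul1r ?mul0r.
  rewrite exchange_big /=; apply: eq_bigr => u _; rewrite -mulr_suml expr2.
  by congr (_ * _); apply: eq_bigr => v _; rewrite adj_sym.
have sumE : \sum_(u in S) deg S u = E by [].
have sum_cst (c : R) : \sum_(u in S) c = n * c by rewrite sumr_const mulr_natl.
have sqr_ge : n * d ^+ 2 <= \sum_(u in S) deg S u ^+ 2.
  have : 0 <= \sum_(u in S) (deg S u - d) ^+ 2 by apply: sumr_ge0 => u _; apply: sqr_ge0.
  rewrite (eq_bigr (fun u => deg S u ^+ 2 + (- (2 * d) * deg S u + d ^+ 2))).
    rewrite !big_split /= -mulr_sumr sumE sum_cst Ed => h.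
    by rewrite -subr_ge0; apply: le_trans h _; apply: eq_ler; ring.
  by move=> u _; ring.
(* The mean of [nd] is the mean squared degree, at least [d ^+ 2]. As [G d <= 0], an excess only
   helps, and [ode] at [d] covers the remainder. *)
have [|v vS gain_v] := @exists_ge_average R V S gain (n * F d) S0.
  rewrite -/n (eq_bigr (fun v => (1 + (n - 1) * F d + G d * (E - (n - 1) * d))
     + ((G d * d - F d) * deg S v + (- (2 * G d)) * nd v))); last first.
    by move=> v _; rewrite /gain; ring.
  rewrite !big_split /= -!mulr_sumr sumE sum_nd !sum_cst.
  have := mulr_ge0 (ltW n0) (ode d0).
  have : 0 <= (- (2 * G d)) * (\sum_(u in S) deg S u ^+ 2 - n * d ^+ 2).
    by rewrite mulr_ge0 ?subr_ge0 // oppr_ge0 pmulr_rle0 ?G_le0.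
  rewrite Ed; set Q := \sum_(u in S) _ => h1 h2.
  rewrite -subr_ge0; apply: le_trans (addr_ge0 h1 h2) _.
  by apply: eq_ler; ring.
have sRS : rest S v \subset S by apply/subsetP => u; rewrite inE => /andP[].
have [|||I [sI indI leI]] := IHm (rest S v).
- apply: leq_trans leSm; apply: proper_card; apply/properP; split=> //.
  by exists v; rewrite // !inE eqxx andbF.
- by move=> x /(subsetP sRS); apply: irr.
- by move=> x y z xR yR zR; apply: tfree; apply: (subsetP sRS).
have vI : v \notin I by apply/negP => /(subsetP sI); rewrite !inE eqxx andbF.
exists (v |: I); split.
- by rewrite subUset sub1set vS (subset_trans sI).
- move=> x y; rewrite !in_setU1 => /orP[/eqP->|xI] /orP[/eqP->|yI].
  + by rewrite irr.
  + by have := subsetP sI _ yI; rewrite inE => /and3P[].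
  + by have := subsetP sI _ xI; rewrite inE adj_sym => /and3P[].
  + exact: indI.
(* Triangle-freeness enters here: the two ends of an edge are never both adjacent to [v], so the
   edges counted from either end by [nd v] and those inside [rest S v] do not overlap. *)
have edges : degsum (rest S v) + 2 * nd v <= E.
  have big_sub (A : {set V}) (f : V -> R) : A \subset S ->
      \sum_(a in A) f a = \sum_(a in S) (a \in A)%:R * f a.
    move=> sAS; rewrite big_mkcond [RHS]big_mkcond /=; apply: eq_bigr => a _.
    case: (boolP (a \in A)) => [aA|aA]; first by rewrite (subsetP sAS _ aA) mul1r.
    by rewrite mul0r; case: ifP.
  have sNS : nbr S v \subset S by apply/subsetP => u; rewrite inE => /andP[].
  rewrite mulr2n mulrDl mul1r addrA /degsum big_sub //.
  rewrite {1}/nd big_sub // [X in _ + X](_ : _ =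
     \sum_(a in S) \sum_(b in S) (b \in nbr S v)%:R * (adj a b)%:R); last first.
    rewrite /nd big_sub // exchange_big /=; apply: eq_bigr => b _.
    by rewrite -mulr_sumr; congr (_ * _); apply: eq_bigr => a _; rewrite adj_sym.
  rewrite -!big_split /=; apply: ler_sum => a aS.
  rewrite big_sub // !mulr_sumr -!big_split /=; apply: ler_sum => b bS.
  have [|nab] := boolP (adj a b); last by rewrite !mulr0 !addr0.
  move=> ab; rewrite !mulr1 -natrM -!natrD ler_nat !inE aS bS /=.
  have := tfree v a b vS aS bS; rewrite ab.
  by case: (adj v a); case: (adj v b); case: (a == v); case: (b == v) => //= /(_ isT isT).
(* The bound is proved at the average degree [d], and [tangent] transfers it to every [x]. A caller
   can thus insert an approximate degree, and as [G x <= 0] an upper bound on [degsum] is enough. *)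
move=> x x0; have le1 : n * F d <= #|v |: I|%:R.
  apply: le_trans gain_v _; rewrite cardsU1 vI add1n -nat1r.
  have := leI d d0; rewrite card_nonnbr ?irr // -/n => h.
  have : G d * (E - 2 * nd v - degsum (rest S v)) <= 0.
    by rewrite mulr_le0_ge0 ?G_le0 // -addrA -opprD subr_ge0 addrC.
  rewrite /gain => h2; rewrite -addrA lerD2l; apply: le_trans h.
  by rewrite -addrA lerD2l -subr_le0 -mulrBr; apply: le_trans h2; apply: eq_ler; ring.
apply: le_trans le1; have := ler_wpM2l (ltW n0) (tangent x0 d0).
rewrite -/E Ed => h; apply: le_trans h.
by apply: eq_ler; ring.
Qed.

End Shearer.

(** * Supersaturation in the Kneser graph *)

Section Cycle.
Variables (R : realFieldType) (n k : nat) (a : nat -> R).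
Hypothesis a_per : forall i, a (i + n)%N = a i.

Lemma sum_shift (g : nat -> R) t : (forall i, g (i + n)%N = g i) ->
  \sum_(i < n) g (i + t)%N = \sum_(i < n) g i.
Proof.
move=> g_per; elim: t => [|t IH]; first by apply: eq_bigr => i _; rewrite addn0.
rewrite -[RHS]IH; case: n g_per {IH} => [|m] g_per; first by rewrite !big_ord0.
rewrite big_ord_recr big_ord_recl addrC /=; congr (_ + _).
  by apply: eq_bigr => i _; rewrite /bump /= add1n addnS addSn.
by rewrite addnS -addSn addnC g_per.
Qed.

Hypotheses (k_gt0 : (0 < k)%N) (le2kn : (2 * k <= n)%N).
Hypothesis a01 : forall i, a i = 0 \/ a i = 1.

(* Katona's cycle argument: for an arc [i] in the family, the arcs meeting it
   fall into [k - 1] pairs [t, t - k] of disjoint arcs. *)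
Lemma katona_cycle :
  (\sum_(i < n) a i) * ((\sum_(i < n) a i) - k%:R) <=
  \sum_(i < n) \sum_(k <= t < (n - k).+1) a i * a (i + t)%N
  + (k%:R - 1) * \sum_(i < n) a i * a (i + k)%N.
Proof.
set m := \sum_(i < n) a i.
have a_ge0 i : 0 <= a i by case: (a01 i) => ->.
have a_le1 i : a i <= 1 by case: (a01 i) => ->.
have bound i : a i * (m - k%:R) <=
    \sum_(k <= t < (n - k).+1) a i * a (i + t)%N
    + \sum_(1 <= t < k) a (i + (n - k) + t)%N * a (i + t)%N.
  (* Offsets around the cycle: 0, the arcs meeting arc [i] on one side, those disjoint from it, and
     those meeting it on the other side, written [n - k + t] to pair them with [t]. *)
  have mE : m = a i + (\sum_(1 <= t < k) a (i + t)%N +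
      (\sum_(k <= t < (n - k).+1) a (i + t)%N
       + \sum_(1 <= t < k) a (i + (n - k) + t)%N)).
    rewrite /m -(sum_shift i a_per) -(big_mkord xpredT (fun j => a (j + i)%N)).
    rewrite big_ltn /=; last lia.
    rewrite (big_cat_nat (n := k)) //=; last lia.
    rewrite (big_cat_nat (n := (n - k).+1) (m := k)) //=; try lia.
    rewrite [X in _ + (_ + (_ + X))](_ : _ = \sum_(1 <= t < k) a (i + (n - k) + t)%N).
      by congr (_ + (_ + (_ + _))); apply: eq_bigr => t _; rewrite addnC.
    rewrite -[(n - k).+1]add1n big_addn (_ : n - (n - k) = k)%N; last lia.
    by apply: eq_bigr => t _; congr a; lia.
  have pairs : \sum_(1 <= t < k) (a (i + t)%N + a (i + (n - k) + t)%N) <=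
      (k%:R - 1) + \sum_(1 <= t < k) a (i + (n - k) + t)%N * a (i + t)%N.
    have -> : k%:R - 1 = \sum_(1 <= t < k) 1 :> R.
      by rewrite sumr_const_nat natrB.
    rewrite -big_split /=; apply: ler_sum => t _.
    by case: (a01 (i + t)) => ->; case: (a01 (i + (n - k) + t)) => ->;
      rewrite ?(mulr0, mul0r, mulr1, addr0, add0r) ?ler01.
  have pos : 0 <= \sum_(1 <= t < k) a (i + (n - k) + t)%N * a (i + t)%N.
    by apply: sumr_ge0 => t _; rewrite mulr_ge0.
  rewrite -mulr_sumr; rewrite big_split /= in pairs.
  case: (a01 i) => ai; first by rewrite ai !mul0r add0r.
  by rewrite mE ai !mul1r; lra.
rewrite mulr_suml.
apply: le_trans (_ : _ <= \sum_(i < n) (\sum_(k <= t < (n - k).+1) a i * a (i + t)%N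
    + \sum_(1 <= t < k) a (i + (n - k) + t)%N * a (i + t)%N)) _; first exact: ler_sum.
rewrite big_split /= lerD2l exchange_big /=.
rewrite (eq_bigr (fun=> \sum_(i < n) a i * a (i + k)%N)).
  by rewrite sumr_const_nat -(natrB _ k_gt0) mulr_natl.
move=> t _.
(* The offsets [n - k + t] and [t] differ by [k] modulo [n], so after a rotation every [t]
   contributes the same sum. *)
rewrite -(@sum_shift (fun i => a i * a (i + k)%N) (n - k + t)).
  apply: eq_bigr => i _; congr (_ * _); first by congr a; lia.
  rewrite -(a_per (i + t)); congr a; lia.
by move=> i; rewrite a_per addnAC a_per.
Qed.

End Cycle.

(** * Transitivity of permutations on ordered pairs of disjoint sets *)

Section SetTransitivity.
Variable T : finType.
Implicit Types A B X Y : {set T}.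

Let s A B := enum A ++ enum B ++ enum (~: (A :|: B)).

Let s_uniq A B : [disjoint A & B] -> uniq (s A B).
Proof.
move=> dAB; rewrite /s !cat_uniq !enum_uniq /= andbT.
apply/andP; split; apply/hasPn => x.
  rewrite mem_cat !mem_enum !inE negb_or => /orP[xB|/andP[]//].
  by rewrite (disjointFl dAB).
by rewrite !mem_enum !inE negb_or => /andP[].
Qed.

Let mem_s A B x : x \in s A B.
Proof. by rewrite /s !mem_cat !mem_enum !inE negb_or; case: (x \in A); case: (x \in B). Qed.

(** List the points of [A], then of [B], then the others, and likewise for [X] and [Y]; matching the
    two lists position by position is the permutation. *)
Lemma perm_pair_transitive A B X Y :
  [disjoint A & B] -> [disjoint X & Y] -> #|A| = #|X| -> #|B| = #|Y| ->
  exists f : {perm T}, f @: A = X /\ f @: B = Y.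
Proof.
move=> dAB dXY cA cB.
have sz (C E : {set T}) : [disjoint C & E] -> size (s C E) = #|T|.
  move=> dCE; rewrite -(card_uniqP (s_uniq dCE)); apply: eq_card => x.
  by rewrite mem_s.
pose f x := nth x (s X Y) (index x (s A B)).
have lt_idx x : (index x (s A B) < size (s X Y))%N.
  by rewrite (sz _ _ dXY) -(sz _ _ dAB) index_mem mem_s.
have f_inj : injective f.
  move=> x y; rewrite /f (set_nth_default x y) // => /eqP.
  rewrite nth_uniq ?s_uniq // => /eqP e.
  by rewrite -(nth_index x (mem_s A B x)) e nth_index ?mem_s.
exists (perm f_inj).
have im (C Z : {set T}) :
    #|C| = #|Z| -> (forall x, x \in C -> f x \in Z) -> perm f_inj @: C = Z.
  move=> cC fC; apply/eqP; rewrite eqEcard card_imset; last exact: perm_inj.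
  rewrite cC leqnn andbT; apply/subsetP => _ /imsetP[x xC ->].
  by rewrite permE fC.
split; apply: im => // x xC; rewrite /f /s index_cat mem_enum.
  rewrite xC nth_cat -cardE -cA cardE index_mem mem_enum xC -mem_enum.
  by rewrite mem_nth // -cardE -cA cardE index_mem mem_enum.
rewrite (disjointFl dAB xC) nth_cat -!cardE -cA ltnNge leq_addr /= addKn.
rewrite index_cat mem_enum xC nth_cat -cardE -cB cardE index_mem mem_enum xC.
by rewrite -mem_enum mem_nth // -cardE -cB cardE index_mem mem_enum.
Qed.

End SetTransitivity.

(** * The disjointness graph, and the cycle bound averaged over permutations *)

Definition disj (n : nat) : rel {set 'I_n} := fun A B => A :&: B == set0.

Lemma disj_sym n : symmetric (@disj n).
Proof. by move=> A B; rewrite /disj setIC. Qed.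

Lemma disj_disjoint n (A B : {set 'I_n}) : disj A B = [disjoint A & B].
Proof. by rewrite /disj setI_eq0. Qed.

Lemma card_ksets n k : #|ksets n k| = 'C(n, k).
Proof. by rewrite card_draws card_ord. Qed.

Lemma card_ksets_disj n k (A : {set 'I_n}) :
  #|[set B in ksets n k | disj A B]| = 'C(n - #|A|, k).
Proof.
have -> : (n - #|A| = #|~: A|)%N by rewrite [in RHS]cardsCs setCK card_ord.
rewrite -cards_draws; apply: eq_card => B.
by rewrite !inE disj_disjoint disjoint_sym disjoints_subset andbC.
Qed.

Section Supersaturation.
Variables (R : realFieldType) (n k : nat).
Hypotheses (k_gt0 : (0 < k)%N) (le2kn : (2 * k <= n)%N).
Local Notation K := (ksets n k).
Local Notation N := ('C(n, k)%:R : R).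
Local Notation D := ('C(n - k, k)%:R : R).

(** A random permutation carries a fixed disjoint pair of k-sets to a uniformly random one: by
    transitivity the sum over all permutations is the same for each starting pair, and the two
    orders of summation are compared. *)
Lemma perm_average (g : {set 'I_n} -> {set 'I_n} -> R) (A B : {set 'I_n}) :
  A \in K -> B \in K -> disj A B ->
  N * D * (\sum_(f : {perm 'I_n}) g (f @: A) (f @: B)) =
  #|{perm 'I_n}|%:R * \sum_(X in K) \sum_(Y in K | disj X Y) g X Y.
Proof.
move=> AK BK dAB; set c := \sum_(f : {perm 'I_n}) _.
have cE X Y : X \in K -> Y \in K -> disj X Y ->
    \sum_(f : {perm 'I_n}) g (f @: X) (f @: Y) = c.
  rewrite !inE !disj_disjoint in AK BK dAB *.
  move=> /eqP XK /eqP YK dXY.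
  have [h [hA hB]] : exists h : {perm 'I_n}, h @: A = X /\ h @: B = Y.
    by apply: perm_pair_transitive; rewrite // ?XK ?YK; apply/eqP.
  rewrite /c [RHS](reindex_inj (mulgI h)) /=; apply: eq_bigr => f _.
  by rewrite -hA -hB -!imset_comp; congr g; apply: eq_imset => x; rewrite /= permM.
transitivity (\sum_(X in K) \sum_(Y in K | disj X Y) c).
  rewrite (eq_bigr (fun=> c *+ 'C(n - k, k))) => [|X].
    by rewrite sumr_const card_ksets -mulrnA -[RHS]mulr_natl natrM; ring.
  rewrite inE => /eqP <-; rewrite -card_ksets_disj -sumr_const; apply: eq_bigl => Y.
  by rewrite !inE.
rewrite (eq_bigr (fun X => \sum_(Y in K | disj X Y)
     \sum_(f : {perm 'I_n}) g (f @: X) (f @: Y))); last first.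
  by move=> X XK; apply: eq_bigr => Y /andP[YK dXY]; rewrite cE.
rewrite (eq_bigr (fun X => \sum_(f : {perm 'I_n}) \sum_(Y in K | disj X Y)
     g (f @: X) (f @: Y))); last by move=> X _; rewrite exchange_big.
rewrite exchange_big /= mulr_natl -sumr_const; apply: eq_bigr => f _.
have im_inj : injective (fun X : {set 'I_n} => f @: X).
  exact: imset_inj perm_inj.
have im_K (X : {set 'I_n}) : (f @: X \in K) = (X \in K).
  by rewrite !inE card_imset //; apply: perm_inj.
have im_disj (X Y : {set 'I_n}) : disj (f @: X) (f @: Y) = disj X Y.
  rewrite /disj -imsetI ?imset_eq0 // => x y _ _; exact: perm_inj.
rewrite [RHS](reindex_inj im_inj); apply: eq_big => [X|X _]; first by rewrite /= im_K.
rewrite [RHS](reindex_inj im_inj); apply: eq_bigl => Y.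
by rewrite im_K im_disj.
Qed.

Let n_gt0 : (0 < n)%N.
Proof. by apply: leq_trans le2kn; rewrite muln_gt0. Qed.

(** Indexed by all naturals and reduced modulo [n], to fit the periodic sequences of the cycle
    argument. *)
Let arc (i : nat) : {set 'I_n} :=
  [set Ordinal (ltn_pmod (i + j) n_gt0) | j : 'I_k].

Let arc_per i : arc (i + n) = arc i.
Proof. by apply: eq_imset => j; apply: val_inj; rewrite /= addnAC modnDr. Qed.

Let arc_K i : arc i \in K.
Proof.
have lt_jn (j : 'I_k) : (j < n)%N by have := ltn_ord j; lia.
rewrite inE card_imset ?card_ord // => j1 j2 /(congr1 val) /= /eqP.
rewrite eqn_modDl !modn_small //.
by move/eqP/val_inj.
Qed.

Let arc_disj i t : (k <= t < (n - k).+1)%N -> disj (arc i) (arc (i + t)).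
Proof.
move=> /andP[kt tn]; rewrite disj_disjoint; apply/pred0P => x /=.
apply/negbTE/negP => /andP[/imsetP[j1 _ ->] /imsetP[j2 _] /(congr1 val) /= /eqP].
have := ltn_ord j1; have := ltn_ord j2 => l2 l1.
rewrite -addnA eqn_modDl !modn_small; lia.
Qed.

(** On average over permutations, the number [m] of arcs in the family has mean [n f / N],
    Cauchy-Schwarz bounds its second moment from below, and [katona_cycle] bounds it from above by
    disjoint arc pairs of total weight [n (n - k)], each present with probability [P / (N D)].
    Denominators are cleared. *)
Lemma supersaturation (F : {set {set 'I_n}}) : F \subset K ->
  D * #|F|%:R * (n%:R * #|F|%:R - k%:R * N) <=
  (n%:R - k%:R) * N * degsum R (@disj n) F.
Proof.
move=> sFK; set f : R := #|F|%:R; set P := degsum _ _ _.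
pose M : R := #|{perm 'I_n}|%:R.
have M0 : 0 < M by rewrite ltr0n; apply/card_gt0P; exists 1%g.
have N0 : 0 < N by rewrite ltr0n bin_gt0; lia.
have D0 : 0 < D by rewrite ltr0n bin_gt0; lia.
pose a (s : {perm 'I_n}) i : R := (s @: arc i \in F)%:R.
pose m s := \sum_(i < n) a s i.
have a_per s i : a s (i + n)%N = a s i by rewrite /a arc_per.
have a01 s i : a s i = 0 \/ a s i = 1 by rewrite /a; case: (_ \in F); [right|left].
(* A single arc is averaged through the pair of arcs [i] and [i + k], with a test function of the
   first. *)
have E1 i : \sum_s a s i = M * f / N.
  have := @perm_average (fun X _ => (X \in F)%:R) _ _ (arc_K i) (arc_K (i + k))
     (arc_disj i (t := k) _).
  rewrite (_ : (k <= k < _)%N); last by lia.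
  move=> /(_ isT); rewrite -/M => e.
  have {e}e : N * D * (\sum_s a s i) = M * (f * D).
    rewrite e; congr (_ * _); rewrite /f -sum1_card natr_sum mulr_suml.
    rewrite big_mkcond [RHS]big_mkcond /=; apply: eq_bigr => X _.
    case: (boolP (X \in F)) => XF; last by case: ifP => // _; rewrite big1.
    rewrite (subsetP sFK _ XF) mul1r sumr_const; congr _%:R.
    have cX : #|X| = k by have := subsetP sFK _ XF; rewrite inE => /eqP.
    have -> : 'C(n - k, k) = #|[set B in K | disj X B]| by rewrite card_ksets_disj cX.
    by apply: eq_card => Y; rewrite unfold_in !inE.
  apply: (mulfI (lt0r_neq0 (mulr_gt0 N0 D0))); rewrite e; field.
  by rewrite gt_eqF.
have E2 i t : (k <= t < (n - k).+1)%N -> \sum_s a s i * a s (i + t)%N = M * P / (N * D).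
  move=> kt.
  have := @perm_average (fun X Y => (X \in F)%:R * (Y \in F)%:R) _ _ (arc_K i)
     (arc_K (i + t)) (arc_disj i kt).
  rewrite -/M => e; apply: (mulfI (lt0r_neq0 (mulr_gt0 N0 D0))); rewrite e.
  rewrite [RHS]mulrC divfK ?gt_eqF ?mulr_gt0 //; congr (_ * _).
  rewrite /P /degsum big_mkcond [RHS]big_mkcond /=; apply: eq_bigr => X _.
  case: (boolP (X \in F)) => XF; last first.
    by case: ifP => // _; rewrite big1 // => Y _; rewrite mul0r.
  rewrite (subsetP sFK _ XF) big_mkcond [RHS]big_mkcond /=; apply: eq_bigr => Y _.
  case: (boolP (Y \in F)) => YF; last by rewrite mulr0; case: ifP.
  by rewrite (subsetP sFK _ YF) mulr1 /=; case: (disj X Y).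
have Em : \sum_s m s = n%:R * (M * f / N).
  rewrite exchange_big /= (eq_bigr (fun=> M * f / N)) //.
  by rewrite sumr_const card_ord mulr_natl.
have sum_cst (c : R) : \sum_(s : {perm 'I_n}) c = M * c by rewrite sumr_const mulr_natl.
have Em2 : (n%:R * (M * f / N)) ^+ 2 <= M * \sum_s m s ^+ 2.
  set x := n%:R * _.
  have : 0 <= \sum_(s : {perm 'I_n}) (M * m s - x) ^+ 2.
    by apply: sumr_ge0 => s _; apply: sqr_ge0.
  rewrite (eq_bigr (fun s => M ^+ 2 * m s ^+ 2 + (- (2 * M * x) * m s + x ^+ 2))).
    rewrite !big_split /= sum_cst -!mulr_sumr Em -/x.
    move: (\sum_(s : {perm 'I_n}) m s ^+ 2) (x) => S2 y h.
    rewrite -subr_ge0 -(pmulr_rge0 _ M0); apply: le_trans h _.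
    by apply: eq_ler; ring.
  by move=> s _; ring.
have sum_ord (c : R) : \sum_(i < n) c = n%:R * c.
  by rewrite sumr_const card_ord mulr_natl.
(* The weight is [(n - 2k + 1) + (k - 1) = n - k] per arc: the offsets from [k] to [n - k], and the
   [k - 1] pairs. *)
have key : \sum_s m s * (m s - k%:R) <= n%:R * (n%:R - k%:R) * (M * P / (N * D)).
  apply: le_trans (ler_sum _ (fun s _ => katona_cycle (a_per s) k_gt0 le2kn (a01 s))) _.
  rewrite big_split /= -mulr_sumr exchange_big [X in _ + _ * X]exchange_big /=.
  rewrite (eq_bigr (fun=> (n%:R - 2 * k%:R + 1) * (M * P / (N * D)))); last first.
    move=> i _; rewrite exchange_big /= big_nat.
    rewrite (eq_bigr (fun=> M * P / (N * D))) => [|t kt]; last by rewrite E2.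
    rewrite -big_nat sumr_const_nat -[LHS]mulr_natl; congr (_ * _).
    rewrite natrB; last lia.
    by rewrite -nat1r natrB; [ring|lia].
  rewrite [X in _ + _ * X](eq_bigr (fun=> M * P / (N * D))); last first.
    by move=> i _; rewrite E2 //; lia.
  rewrite !sum_ord.
  by apply: eq_ler; ring.
rewrite (eq_bigr (fun s => m s ^+ 2 + (- k%:R) * m s)) in key; last by move=> s _; ring.
rewrite big_split /= -mulr_sumr Em in key.
have n0 : 0 < n%:R :> R by rewrite ltr0n.
have := lerD Em2 (ler_wpM2l (ltW M0) key).
rewrite -subr_ge0 => h.
rewrite -subr_ge0 -(pmulr_rge0 _ (_ : 0 < M ^+ 2 * n%:R / (N ^+ 2 * D))); last first.
  by rewrite divr_gt0 ?mulr_gt0 ?exprn_gt0.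
apply: le_trans h _; apply: eq_ler.
by field; rewrite !gt_eqF.
Qed.

(** Some vertex has at least the average degree; dropping the factor [n / (n - k)] puts the bound
    into the form that [container] asks for, with [q = D / N] and [kap = k N / n]. *)
Lemma kneser_dense (A : {set {set 'I_n}}) : A \subset K -> A != set0 ->
  exists2 v, v \in A &
    D / N * (#|A|%:R - k%:R / n%:R * N) <= #|[set u in A | disj v u]|%:R.
Proof.
move=> sAK A0; have := supersaturation sAK; set f : R := #|A|%:R => sup.
have N0 : 0 < N by rewrite ltr0n bin_gt0; lia.
have D0 : 0 < D by rewrite ltr0n bin_gt0; lia.
have n0 : 0 < n%:R :> R by rewrite ltr0n.
have f0 : 0 < f by rewrite ltr0n card_gt0.
have nk0 : 0 < n%:R - k%:R :> R by rewrite subr_gt0 ltr_nat; lia.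
have [|v vA le] := @exists_ge_average R _ A (fun v => \sum_(u in A) (disj v u)%:R)
   (D / N * (f - k%:R / n%:R * N)) A0; last first.
  exists v => //; apply: le_trans le _; rewrite sum_adj_card; apply: lexx.
rewrite -/f -/(degsum R (@disj n) A).
have P0 : 0 <= degsum R (@disj n) A by do 2!apply: sumr_ge0 => ? _.
have [neg|pos] := lerP (f - k%:R / n%:R * N) 0.
  by apply: le_trans P0; rewrite mulr_ge0_le0 ?(ltW f0) // mulr_ge0_le0 // ltW ?divr_gt0.
rewrite -(ler_pM2l (mulr_gt0 nk0 N0)); apply: le_trans sup.
have -> : D * f * (n%:R * f - k%:R * N) = n%:R * (D * f * (f - k%:R / n%:R * N)).
  by field; rewrite gt_eqF.
have -> : (n%:R - k%:R) * N * (f * (D / N * (f - k%:R / n%:R * N))) =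
  (n%:R - k%:R) * (D * f * (f - k%:R / n%:R * N)).
  by field; rewrite !gt_eqF.
by rewrite ler_wpM2r ?mulr_ge0 ?(ltW D0) ?(ltW f0) ?(ltW pos) // gerBl.
Qed.

End Supersaturation.

(** * Tail bounds for the random hypergraph *)

Section MaxIntersecting.
Variable n : nat.
Implicit Types (F H : hypergraph n).

Lemma intersectingP F :
  reflect {in F &, forall A B, ~~ disj A B} (intersecting F).
Proof.
apply: (iffP forall_inP) => [iF A B AF BF|iF A AF].
  exact: (forall_inP (iF A AF)).
by apply/forall_inP => B BF; apply: iF.
Qed.

Lemma max_intersecting_ge F H :
  F \subset H -> intersecting F -> (#|F| <= max_intersecting H)%N.
Proof.
move=> sFH iF; rewrite /max_intersecting (bigD1 F) /= ?sFH //.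
exact: leq_maxl.
Qed.

Lemma max_intersecting_ex H :
  exists F, [/\ F \subset H, intersecting F & #|F| = max_intersecting H].
Proof.
have P0 : (set0 \subset H) && intersecting (set0 : hypergraph n).
  by rewrite sub0set; apply/intersectingP => A B; rewrite in_set0.
have [|F /andP[sFH iF] e] := @eq_bigmax_cond _
  [pred F : hypergraph n | (F \subset H) && intersecting F] (fun F => #|F|).
  by apply/card_gt0P; exists set0.
by exists F; split => //; rewrite -e.
Qed.

Lemma max_intersecting_le H : (max_intersecting H <= #|H|)%N.
Proof. by have [F [sFH _ <-]] := max_intersecting_ex H; apply: subset_leq_card. Qed.

End MaxIntersecting.

Section HypergraphTails.
Variables (R : realType) (n k : nat) (p : R).
Hypotheses (k_gt0 : (0 < k)%N) (le2kn : (2 * k <= n)%N) (p01 : 0 <= p <= 1).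
Local Notation K := (ksets n k).
Local Notation N := ('C(n, k)%:R : R).
Local Notation D := ('C(n - k, k)%:R : R).
Local Notation EX := (expect (ksets n k) p).
Implicit Types (F H T : hypergraph n).

Let N_gt0 : 0 < N. Proof. by rewrite ltr0n bin_gt0; lia. Qed.
Let D_gt0 : 0 < D. Proof. by rewrite ltr0n bin_gt0; lia. Qed.
Let n_gt0 : 0 < n%:R :> R. Proof. by rewrite ltr0n; lia. Qed.

Lemma hyp_prob_ge (E : hypergraph n -> bool) (g : hypergraph n -> R) :
  (forall H, H \subset K -> 0 <= g H) ->
  (forall H, H \subset K -> g H < 1 -> E H) ->
  1 - EX g <= hyp_prob k p E.
Proof. exact: prob_ge_1Bexpect. Qed.

Lemma hyp_prob_le1 (E : hypergraph n -> bool) : hyp_prob k p E <= 1.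
Proof.
rewrite -[leRHS](expect_cst K p 1) /hyp_prob big_mkcondr /=; apply: ler_sum => H _.
by rewrite mulr1; case: ifP => // _; apply: bwt_ge0.
Qed.

Lemma expect_card_variance (C : hypergraph n) : C \subset K ->
  EX (fun H => (#|H :&: C|%:R - p * #|C|%:R) ^+ 2) <= p * #|C|%:R.
Proof.
move=> sCK; have d0C : [disjoint (set0 : hypergraph n) & C].
  by rewrite disjoints_subset sub0set.
have := expect_incl_variance p01 (sub0set K) sCK d0C.
rewrite cards0 expr0 mul1r; apply: le_trans.
by apply: ler_expect => // H _; rewrite sub0set mul1r.
Qed.

(** ['C(m, s) * z ^+ s] is one term in the expansion of [(1 + z) ^+ m]. *)
Lemma binom_le_expR (m s : nat) (z : R) : 0 < z ->
  'C(m, s)%:R <= expR (z * m%:R) / z ^+ s.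
Proof.
move=> z0; rewrite ler_pdivlMr ?exprn_gt0 //.
apply: (@le_trans _ _ ((z + 1) ^+ m)); last first.
  rewrite mulrC expRM_natl lerXn2r ?nnegrE ?expR_ge0 ?addr_ge0 ?(ltW z0) //.
  by rewrite addrC expR_ge1Dx.
have [lesm|ltms] := leqP s m; last first.
  by rewrite bin_small // mul0r exprn_ge0 // addr_ge0 ?(ltW z0).
rewrite addrC exprDn (bigD1 (Ordinal (lesm : (s < m.+1)%N))) //= expr1n mul1r.
rewrite mulr_natl lerDl sumr_ge0 // => i _; rewrite expr1n mul1r mulrn_wge0 //.
by rewrite exprn_ge0 // ltW.
Qed.

(** An intersecting family of at least [s + t] edges contains a fingerprint [T] of size [s] and has
    at least [t] further edges in its container. Markov's inequality is applied to the sum of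
    [(1 + x)^(#|H :&: C' T| - t)] over the [T] contained in [H]; [x] remains free. *)
Lemma upper_tail (s t : nat) (x : R) : 0 <= x ->
  1 - expR (N / D + p * x * (N * (k%:R / n%:R + expR (- (s%:R * (D / N)))))) *
      (p * D) ^+ s / (1 + x) ^+ t
  <= hyp_prob k p (fun H => max_intersecting H < s + t)%N.
Proof.
move=> x0.
have [p0 p1] := andP p01.
have DN : D <= N by rewrite ler_nat leq_bin2l // leq_subr.
have q01 : 0 <= D / N <= 1.
  by rewrite divr_ge0 ?(ltW D_gt0) ?(ltW N_gt0) //= ler_pdivrMr // mul1r.
have kap0 : 0 <= k%:R / n%:R * N by rewrite mulr_ge0 ?divr_ge0.
have leK : #|K|%:R <= k%:R / n%:R * N + N by rewrite card_ksets lerDr.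
have [C [Cle CP]] := @container R _ (@disj n) K (D / N) (k%:R / n%:R * N) q01 kap0
  (@kneser_dense R n k k_gt0 le2kn) s N K (subxx _) (ltW N_gt0) leK.
(* Removing [T] makes the presence of the fingerprint independent of the edges counted in its
   container. *)
pose C' T := (C T :&: K) :\: T.
have x1 : 0 < 1 + x by rewrite ltr_pwDl.
pose rho := N * (k%:R / n%:R + expR (- (s%:R * (D / N)))).
have C'le T : #|C' T|%:R <= rho.
  apply: le_trans (_ : #|C T|%:R <= _).
    by rewrite ler_nat subset_leq_card // (subset_trans (subsetDl _ _)) ?subsetIl.
  apply: le_trans (Cle T) _; rewrite /rho mulrDr [N * _]mulrC lerD2l ler_wpM2l ?(ltW N_gt0) //.
  rewrite -[- (s%:R * _)]mulrN expRM_natl lerXn2r ?nnegrE ?expR_ge0 ?expR_ge1Dx ?subr_ge0 //.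
  by case/andP: q01.
pose g H := \sum_(T : hypergraph n | (T \subset K) && (#|T| == s))
   (1 + x) ^- t * ((T \subset H)%:R * (1 + x) ^+ #|H :&: C' T|).
have Eg : EX g <= expR (N / D + p * x * rho) * (p * D) ^+ s / (1 + x) ^+ t.
  rewrite expect_sum.
  apply: le_trans (_ : _ <= \sum_(T : hypergraph n | (T \subset K) && (#|T| == s))
     (1 + x) ^- t * (p ^+ s * expR (p * x * rho))) _.
    apply: ler_sum => T /andP[sTK /eqP cT].
    rewrite expectZ expect_incl_mgf //; last first.
    - by rewrite disjoints_subset; apply/subsetP => A AT; rewrite !inE AT.
    - by rewrite (subset_trans (subsetDl _ _)) ?subsetIr.
    rewrite cT ler_wpM2l ?invr_ge0 ?exprn_ge0 ?(ltW x1) // ler_wpM2l ?exprn_ge0 //.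
    apply: le_trans (_ : _ <= expR (p * x) ^+ #|C' T|) _.
      by rewrite lerXn2r ?nnegrE ?expR_ge0 ?expR_ge1Dx // addr_ge0 ?mulr_ge0.
    by rewrite -expRM_natr ler_expR ler_wpM2l ?mulr_ge0.
  rewrite sumr_const (_ : #|_| = 'C('C(n, k), s)); last first.
    rewrite -(card_ksets n k) -cards_draws; apply: eq_card => T; rewrite unfold_in !inE.
    by [].
  rewrite -[_ *+ _]mulr_natl.
  (* The choice [z = 1 / D] merges the number of fingerprints with [p ^+ s] into [(p * D) ^+ s], at
     the price [expR (N / D)]. *)
  apply: le_trans (ler_wpM2r _ (binom_le_expR _ _ (_ : 0 < D^-1))) _; last 2 first.
  - by rewrite invr_gt0.
  - rewrite expRD exprMn [D^-1 * N]mulrC exprVn invrK; apply: eq_ler.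
    by ring.
  by rewrite mulr_ge0 ?invr_ge0 ?exprn_ge0 ?mulr_ge0 ?exprn_ge0 ?expR_ge0 ?(ltW x1).
apply: le_trans (_ : 1 - EX g <= _); first by rewrite lerD2l lerN2.
have term0 H T : 0 <= (1 + x) ^- t * ((T \subset H)%:R * (1 + x) ^+ #|H :&: C' T|).
  by rewrite mulr_ge0 ?invr_ge0 ?exprn_ge0 ?mulr_ge0 ?exprn_ge0 ?(ltW x1).
apply: hyp_prob_ge => H sHK; first exact: sumr_ge0.
apply: contraTT; rewrite -leqNgt -leNgt => big.
have [I [sIH iI cI]] := max_intersecting_ex H.
have [|||T [sTI cT sC]] := CP I.
- exact: subset_trans sHK.
- by rewrite cI (leq_trans _ big) ?leq_addr.
- exact/intersectingP.
rewrite /g (bigD1 T) /=; last first.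
  by rewrite cT eqxx andbT (subset_trans sTI) // (subset_trans sIH).
apply: le_trans (_ : _ <= (1 + x) ^- t * ((T \subset H)%:R * (1 + x) ^+ #|H :&: C' T|)) _.
  2: by rewrite lerDl sumr_ge0.
rewrite (subset_trans sTI sIH) mul1r mulrC ler_pdivlMr ?exprn_gt0 // mul1r.
apply: ler_weXn2l; first by rewrite lerDl.
have : (#|I :\: T| <= #|H :&: C' T|)%N.
  apply: subset_leq_card; apply/subsetP => A AI; rewrite !inE.
  have AinC := subsetP sC _ AI; move: AI; rewrite !inE AinC => /andP[-> AI] /=.
  by rewrite (subsetP sIH _ AI) /=; have := subsetP sHK _ (subsetP sIH _ AI); rewrite inE.
by apply: leq_trans; rewrite cardsD (finset.setIidPr sTI) cT cI -(leq_add2l s)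
  subnKC // (leq_trans (leq_addr t s) big).
Qed.

End HypergraphTails.

(** * Rounding and elementary logarithm bounds *)

Section RealLemmas.
Variable R : realType.
Implicit Types x y z : R.

Lemma nat_floor x : 0 <= x -> exists t : nat, t%:R <= x < t.+1%:R.
Proof. by move=> x0; exists (Num.truncn x); apply: truncn_itv. Qed.

Lemma nat_ceil x : 0 <= x -> exists s : nat, x <= s%:R <= x + 1.
Proof.
move=> /nat_floor[t /andP[h1 h2]]; exists t.+1.
by rewrite ltW //= -natr1 lerD2r.
Qed.

Lemma ln_le_subr1 x : 0 < x -> ln x <= x - 1.
Proof.
move=> x0; have := @le_ln1Dx R (x - 1); rewrite addrCA subrr addr0; apply.
by rewrite ltrBDl subrr.
Qed.

Lemma ln_ge_1Bdiv x : 0 < x -> 1 - x^-1 <= ln x.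
Proof.
move=> x0; have := @ln_le_subr1 x^-1; rewrite invr_gt0 lnV ?posrE // => /(_ x0).
by lra.
Qed.

Lemma ln_ge_half x : 2 <= x -> 1 / 2 <= ln x.
Proof. 
move=> x2; have x0 : 0 < x by lra.
apply: le_trans (ln_ge_1Bdiv x0) => //.
have : x^-1 <= 2^-1 by rewrite lef_pV2 ?posrE //; lra.
by lra.
Qed.

End RealLemmas.

Lemma hyp_prob_mono (R : realType) (n k : nat) (p : R) (E E' : hypergraph n -> bool) :
  0 <= p <= 1 -> (forall H, E H -> E' H) -> hyp_prob k p E <= hyp_prob k p E'.
Proof.
move=> p01 EE'; rewrite /hyp_prob big_mkcondr [leRHS]big_mkcondr; apply: ler_sum => H _.
case: (boolP (E H)) => [/EE' ->|_] //; case: ifP => // _; exact: bwt_ge0.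
Qed.

(** * Choosing the parameters of the tail bound *)

Section UpperBounds.
Variables (R : realType) (n k : nat) (p : R).
Hypotheses (k_gt0 : (0 < k)%N) (le2kn : (2 * k <= n)%N) (p01 : 0 < p < 1).
Local Notation N := ('C(n, k)%:R : R).
Local Notation D := ('C(n - k, k)%:R : R).
Local Notation Q := ('C(n, k)%:R / 'C(n - k, k)%:R : R).
Local Notation r := (n%:R / k%:R : R).
Local Notation y := (p * 'C(n - k, k)%:R).

Let N_gt0 : 0 < N. Proof. by rewrite ltr0n bin_gt0; lia. Qed.
Let D_gt0 : 0 < D. Proof. by rewrite ltr0n bin_gt0; lia. Qed.
Let n_gt0 : 0 < n%:R :> R. Proof. by rewrite ltr0n; lia. Qed.
Let k_gt0R : 0 < k%:R :> R. Proof. by rewrite ltr0n; lia. Qed.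

Lemma quot_ge1 : 1 <= Q.
Proof. by rewrite ler_pdivlMr // mul1r ler_nat leq_bin2l // leq_subr. Qed.

Lemma ratio_ge2 : 2 <= r.
Proof. by rewrite ler_pdivlMr // -natrM ler_nat. Qed.

(** In the exponent, [Q + s ln y] is the price of the fingerprint, the next term that of tilting the
    container by [1 + x], and the last the gain from [t] edges. *)
Lemma upper_tail_expR (s t : nat) (x : R) : 0 <= x ->
  1 - expR (Q + s%:R * ln y + x * y * Q * (r^-1 + expR (- (s%:R / Q)))
            - t%:R * ln (1 + x))
  <= hyp_prob k p (fun H : hypergraph n => max_intersecting H < s + t)%N.
Proof.
move=> x0; have /andP[p0 p1] := p01.
have p01' : 0 <= p <= 1 by rewrite !ltW.
apply: le_trans (upper_tail k_gt0 le2kn p01' s t x0).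
have y0 : 0 < y by rewrite mulr_gt0.
have x1 : 0 < 1 + x by rewrite ltr_pwDl.
have -> : y ^+ s = expR (s%:R * ln y) by rewrite expRM_natl lnK ?posrE.
have -> : (1 + x) ^+ t = expR (t%:R * ln (1 + x)) by rewrite expRM_natl lnK ?posrE.
rewrite lerD2l lerN2 -expRN -!expRD ler_expR.
have -> : D / N = Q^-1 by rewrite invf_div.
have -> : r^-1 = k%:R / n%:R by rewrite invf_div.
apply: eq_ler; field.
by rewrite !gt_eqF.
Qed.

(** From [y <= r^(1 - eps)] follows [1 / r <= y^-(1 + eps)], and [s >= 2 Q ln y] brings the other
    part of the container to the same level. The tilt [x = y^eps] then costs at most [2 Q], while
    each edge beyond the fingerprint gains [eps ln y]. *)
Lemma upper_sparse (eps : R) : 0 < eps < 1 -> 1 <= ln y -> y <= r `^ (1 - eps) ->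
  1 - expR (- (ln y) ^+ 2) <= hyp_prob k p (fun H : hypergraph n =>
     (max_intersecting H)%:R <= (3 + 7 / eps) * Q * ln y).
Proof.
(* The fingerprint has at most [3 Q L] vertices, so [t >= (7 / eps) Q L], a gain of [7 Q L^2]. This
   pays for [Q], for [s L <= 3 Q L^2] and for the [2 Q] of the container, and leaves
   [Q L^2 >= L^2]. *)
move=> /andP[e0 e1] L1 yr; have /andP[p0 p1] := p01.
have y0 : 0 < y by rewrite mulr_gt0.
have Q1 := quot_ge1; have Q0 : 0 < Q := lt_le_trans ltr01 Q1; have r2 := ratio_ge2.
set C : R := 3 + 7 / eps; set L := ln y in L1 *.
have QL1 : 1 <= Q * L by rewrite mulr_ege1.
have eC : eps * (C - 3) = 7 by rewrite /C addrC addKr mulrC divfK ?gt_eqF.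
have C3 : 3 <= C by rewrite lerDl divr_ge0 // ltW.
have [s /andP[s1 s2]] : exists s : nat, 2 * (Q * L) <= s%:R <= 2 * (Q * L) + 1.
  by apply: nat_ceil; rewrite mulr_ge0 //; lra.
(* The tail bound concerns [max_intersecting H < s + t]; with [s + t = T.+1] this reads [<= T]. *)
have [T /andP[T1 T2]] : exists T : nat, T%:R <= C * (Q * L) < T.+1%:R.
  by apply: nat_floor; rewrite mulr_ge0 //; lra.
have sT : (s <= T.+1)%N.
  rewrite -(ler_nat R); apply: le_trans (ltW T2); apply: le_trans s2 _.
  by apply: (@le_trans _ _ (3 * (Q * L))); [lra|rewrite ler_wpM2r //; lra].
have t2 : (C - 3) * (Q * L) <= (T.+1 - s)%:R by rewrite natrB //; lra.
have x0 : 0 <= expR (eps * L) := expR_ge0 _.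
have := upper_tail_expR s (T.+1 - s) x0; rewrite -/L subnKC // => tail.
have rL : r^-1 <= expR (- ((1 + eps) * L)).
  rewrite expRN lef_pV2 ?posrE ?expR_gt0 ?divr_gt0 //.
  rewrite -[leRHS](@lnK _ r) ?posrE ?divr_gt0 // ler_expR.
  have lnr0 : 0 <= ln r by rewrite ln_ge0 //; lra.
  have : L <= (1 - eps) * ln r.
    rewrite -ln_powR ler_ln ?posrE ?powR_gt0 ?divr_gt0 //.
  by move=> h; nra.
have sQ : expR (- (s%:R / Q)) <= expR (- ((1 + eps) * L)).
  rewrite ler_expR lerN2 ler_pdivlMr; last lra.
  by apply: le_trans s1; nra.
apply: le_trans (le_trans tail _); last first.
  apply: hyp_prob_mono; first by rewrite !ltW.
  by move=> H; rewrite ltnS -(ler_nat R) -mulrA => h; apply: le_trans h T1.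
rewrite lerD2l lerN2 ler_expR.
have xb : expR (eps * L) * y * Q * (r^-1 + expR (- (s%:R / Q))) <= 2 * Q.
  have -> : y = expR L by rewrite lnK ?posrE.
  rewrite -expRD (_ : eps * L + L = (1 + eps) * L); last by ring.
  apply: (@le_trans _ _ (expR ((1 + eps) * L) * Q * (2 * expR (- ((1 + eps) * L))))).
    apply: ler_wpM2l; first by rewrite mulr_ge0 ?expR_ge0 ?(ltW Q0).
    set E := expR (- ((1 + eps) * L)) in rL sQ *.
    by apply: le_trans (lerD rL sQ) _; rewrite -mulr2n mulr_natl.
  rewrite expRN; apply: eq_ler; field.
  by rewrite !gt_eqF ?expR_gt0.
have lx : eps * L <= ln (1 + expR (eps * L)).
  rewrite -{1}(expRK (eps * L)) ler_ln ?posrE ?expR_gt0 ?lerDr //.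
  by rewrite addr_gt0 ?expR_gt0.
have h1 : (T.+1 - s)%:R * ln (1 + expR (eps * L)) >= 7 * (Q * L ^+ 2).
  apply: (@le_trans _ _ ((C - 3) * (Q * L) * (eps * L))).
    rewrite -eC; apply: eq_ler; ring.
  by rewrite ler_pM // mulr_ge0 ?subr_ge0 //; lra.
have h2 : s%:R * L <= 3 * (Q * L ^+ 2).
  rewrite expr2 !mulrA ler_wpM2r //; lra.
have h3 : Q <= Q * L ^+ 2 by rewrite ler_peMr ?exprn_ege1 //; lra.
have h4 : L ^+ 2 <= Q * L ^+ 2 by rewrite ler_peMl ?sqr_ge0.
by lra.
Qed.

(** Here [mu = Q w] with [w = y / r]. The fingerprint costs about [Q (ln r + A) (ln w + ln r)], a
    small fraction of [Q w] because [ln w <= 2 sqrt w] and [sqrt w >= M ln r]. Tilting by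
    [1 + eps / 8] gains [c mu] net of the container, and half of that pays for the fingerprint. *)
Lemma upper_dense (eps : R) : 0 < eps < 1 ->
  let A : R := ln (8 / eps) + 1 in
  let c := eps ^+ 2 / 64 in
  let mu := p * (k%:R / n%:R) * N in
  (26 * A / c) ^+ 2 * r * ln r ^+ 2 * D^-1 <= p ->
  1 - expR (- (c / 2 * mu)) <= hyp_prob k p (fun H : hypergraph n =>
     (max_intersecting H)%:R <= (1 + eps) * mu).
Proof.
move=> /andP[e0 e1] A c mu pM; have /andP[p0 p1] := p01.
have y0 : 0 < y by rewrite mulr_gt0.
have Q1 := quot_ge1; have Q0 : 0 < Q := lt_le_trans ltr01 Q1; have r2 := ratio_ge2.
have A1 : 1 <= A.
  rewrite lerDr ln_ge0 // ler_pdivlMr //; lra.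
have c0 : 0 < c by rewrite divr_gt0 ?exprn_gt0.
have c1 : c <= 1 / 64 by rewrite /c; nra.
pose l := ln r; have l2 : 1 / 2 <= l by apply: ln_ge_half.
(* 26 is twice [4 + 3 + 6], the coefficients in [i4], [i2] and [i3] that bound the parts of [small];
   the factor 2 comes from [c / 2]. *)
pose M := 26 * A / c.
have M0 : 26 * A <= M * c by rewrite /M divfK ?gt_eqF.
have Mpos : 0 < M by rewrite divr_gt0 //; lra.
have M1 : 64 * 26 * A <= M by rewrite /M ler_pdivlMr //; nra.
pose w := y / r.
have r0 : 0 < r by rewrite divr_gt0.
have w0 : 0 < w by rewrite divr_gt0.
have wM : M ^+ 2 * l ^+ 2 <= w.
  rewrite /w ler_pdivlMr // mulrAC -ler_pdivrMr //.
have muE : mu = Q * w.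
  rewrite /mu /w; field; rewrite !gt_eqF //.
pose v := Num.sqrt w.
have v0 : 0 < v by rewrite sqrtr_gt0.
have vv : v ^+ 2 = w by rewrite sqr_sqrtr // ltW.
have Ml0 : 0 <= M * l by rewrite mulr_ge0 ?(ltW Mpos) //; lra.
have v2M : (M * l) ^+ 2 <= v ^+ 2 by rewrite vv exprMn.
have vM : M * l <= v by rewrite -ler_sqr ?nnegrE ?(ltW v0).
have lnw : ln w <= 2 * v.
  by rewrite -vv lnXn // mulr2n; have := ln_sublinear v0; lra.
have lny : ln y = ln w + l.
  by rewrite -lnM ?posrE // /w divfK ?gt_eqF.
have lnr : ln (8 * r / eps) = l + A - 1.
  have -> : 8 * r / eps = r * (8 / eps) by ring.
  by rewrite lnM ?posrE ?divr_gt0 // /A /l; ring.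
(* [s / Q >= ln (8 r / eps)] keeps the container within a factor [1 + eps / 8] of the size of a
   star. *)
have [s /andP[s1 s2]] : exists s : nat, Q * (l + A - 1) <= s%:R <= Q * (l + A - 1) + 1.
  by apply: nat_ceil; rewrite mulr_ge0 //; lra.
have sQ : s%:R <= Q * (l + A) by lra.
have lA : l + A <= 3 * A * l by nra.
have ll : l / 2 <= l ^+ 2 by rewrite expr2 mulrC ler_wpM2r //; lra.
have l20 : 0 <= l ^+ 2 := sqr_ge0 _.
have smu : s%:R <= eps / 4 * mu.
  rewrite muE -vv; apply: le_trans sQ _; rewrite mulrCA; apply: ler_wpM2l; first exact: ltW.
  have Me : 64 * 26 * A <= M * eps.
    have ee : M * eps ^+ 2 <= M * eps by rewrite ler_pM2l // expr2; nra.
    have cE : M * c * 64 = M * eps ^+ 2 by rewrite /c; field.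
    lra.
  apply: (@le_trans _ _ (6 * A * l ^+ 2)); first by nra.
  apply: (@le_trans _ _ (eps / 4 * (M * l) ^+ 2)); last by rewrite ler_wpM2l //; lra.
  have -> : eps / 4 * (M * l) ^+ 2 = (M * eps) * M * l ^+ 2 / 4 by rewrite exprMn; field.
  have : 64 * 26 * A * 1 <= M * eps * M by apply: ler_pM => //; lra.
  by move=> h; nra.
have y1 : 1 <= y.
  have -> : y = w * r by rewrite /w divfK ?gt_eqF.
  apply: mulr_ege1; last by lra.
  apply: le_trans wM; rewrite -exprMn exprn_ege1 //; nra.
have lny0 : 0 <= ln y by apply: ln_ge0.
have small : 1 + (l + A) * ln y <= c / 2 * w.
  rewrite -(ler_pM2l Mpos) lny -[X in c / 2 * X]vv.
  have i1 : M * l * l <= v * v by apply: ler_pM => //; nra.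
  have i2 : M * ((l + A) * l) <= 3 * A * (v * v).
    apply: (@le_trans _ _ (3 * A * (M * l * l))); last by rewrite ler_wpM2l //; lra.
    have := ler_wpM2r (_ : 0 <= M * l) lA; move=> /(_ Ml0); lra.
  have i3 : M * ((l + A) * ln w) <= 6 * A * (v * v).
    apply: (@le_trans _ _ (M * (3 * A * l * (2 * v)))).
      rewrite ler_pM2l //; apply: (@le_trans _ _ ((l + A) * (2 * v))).
        by rewrite ler_wpM2l //; lra.
      by rewrite ler_wpM2r //; lra.
    have : 6 * A * (M * l * v) <= 6 * A * (v * v).
      by rewrite ler_wpM2l; [|lra|rewrite ler_wpM2r // ltW].
    lra.
  have i4 : M * 1 <= 4 * (v * v).
    apply: (@le_trans _ _ (4 * (M * l * l))); last by lra.
    have : M * 1 <= M * (4 * l ^+ 2) by rewrite ler_pM2l //; nra.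
    lra.
  have i5 : 13 * A * (v * v) <= M * (c / 2 * v ^+ 2).
    have := ler_wpM2r (_ : 0 <= v * v) M0; rewrite mulr_ge0 ?(ltW v0) // => /(_ isT).
    lra.
  have i6 : v * v <= A * (v * v) by rewrite ler_peMl // mulr_ge0 // ltW.
  lra.
have mu0 : 0 < mu by rewrite muE mulr_gt0.
have [T /andP[T1 T2]] : exists T : nat, T%:R <= (1 + eps) * mu < T.+1%:R.
  by apply: nat_floor; rewrite mulr_ge0 ?(ltW mu0) //; lra.
have sT : (s <= T.+1)%N.
  rewrite -(ler_nat R); apply: le_trans (ltW T2); apply: le_trans smu _.
  by rewrite ler_wpM2r ?(ltW mu0) //; lra.
have t2 : (1 + 3 / 4 * eps) * mu <= (T.+1 - s)%:R by rewrite natrB //; lra.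
have x0 : 0 <= eps / 8 by lra.
have := upper_tail_expR s (T.+1 - s) x0; rewrite subnKC // => tail.
apply: le_trans (le_trans tail _); last first.
  apply: hyp_prob_mono; first by rewrite !ltW.
  by move=> H; rewrite ltnS -(ler_nat R) => h; apply: le_trans h T1.
rewrite lerD2l lerN2 ler_expR.
have b1 : Q + s%:R * ln y <= c / 2 * mu.
  rewrite muE mulrCA; apply: (@le_trans _ _ (Q * (1 + (l + A) * ln y))).
    by rewrite mulrDr mulr1 lerD2l mulrA ler_wpM2r.
  by rewrite ler_pM2l.
have b2 : eps / 8 * y * Q * (r^-1 + expR (- (s%:R / Q))) <= eps / 8 * (1 + eps / 8) * mu.
  have p8 : 0 < 8 * r / eps by rewrite divr_gt0 // mulr_gt0.
  have e8 : expR (- (s%:R / Q)) <= eps / 8 * r^-1.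
    have -> : eps / 8 * r^-1 = expR (- (l + A - 1)).
      rewrite -lnr expRN lnK ?posrE //.
      by rewrite [RHS]invf_div (invfM 8 r) mulrA.
    by rewrite ler_expR lerN2 ler_pdivlMr // mulrC.
  apply: (@le_trans _ _ (eps / 8 * y * Q * (r^-1 + eps / 8 * r^-1))).
    apply: ler_wpM2l; last by rewrite lerD2l.
    by rewrite mulr_ge0 ?(ltW Q0) // mulr_ge0 // ltW.
  rewrite muE /w; apply: eq_ler; field.
  by rewrite !gt_eqF.
have b3 : (c + eps / 8 * (1 + eps / 8)) * mu <= (T.+1 - s)%:R * ln (1 + eps / 8).
  have x1 : 0 < 1 + eps / 8 by lra.
  apply: (@le_trans _ _ ((1 + 3 / 4 * eps) * mu * (1 - (1 + eps / 8)^-1))).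
    rewrite [leRHS]mulrAC ler_wpM2r ?(ltW mu0) //.
    have -> : 1 - (1 + eps / 8)^-1 = eps / 8 / (1 + eps / 8) by field; lra.
    rewrite mulrA ler_pdivlMr // /c.
    have : eps ^+ 2 <= eps by rewrite expr2; nra.
    have : 0 <= eps ^+ 2 := sqr_ge0 _.
    have : eps ^+ 3 <= eps ^+ 2 by rewrite exprS; nra.
    lra.
  apply: ler_pM => //; last exact: ln_ge_1Bdiv.
    by rewrite mulr_ge0 ?(ltW mu0) //; lra.
  rewrite subr_ge0 invf_le1 //; lra.
lra.
Qed.


End UpperBounds.

(** * Lower bounds *)

Lemma sqr_div_lt1 (R : realFieldType) (z l : R) : 0 < l -> z ^+ 2 / l ^+ 2 < 1 -> - l < z < l.
Proof.
move=> l0; rewrite ltr_pdivrMr ?exprn_gt0 // mul1r => h.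
by apply/andP; split; rewrite ltNge; apply/negP => lz; nra.
Qed.

Lemma mul_bin_subn (n k : nat) : (0 < k)%N ->
  (n * ('C(n, k) - 'C(n - 1, k)) = k * 'C(n, k))%N.
Proof.
case: n k => [|n] [|k] //= _; first by rewrite mul0n bin0n /= muln0.
by rewrite subn1 /= {1}binS addKn -mul_bin_diag.
Qed.

Section LowerBounds.
Variables (R : realType) (n k : nat) (p : R).
Hypotheses (k_gt0 : (0 < k)%N) (le2kn : (2 * k <= n)%N) (p01 : 0 < p < 1).
Local Notation K := (ksets n k).
Local Notation N := ('C(n, k)%:R : R).
Local Notation D := ('C(n - k, k)%:R : R).
Local Notation D2 := ('C(n - 2 * k, k)%:R : R).
Local Notation EX := (expect (ksets n k) p).
Implicit Types (F H T : hypergraph n) (A B C : {set 'I_n}).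

Let N_gt0 : 0 < N. Proof. by rewrite ltr0n bin_gt0; lia. Qed.
Let D_gt0 : 0 < D. Proof. by rewrite ltr0n bin_gt0; lia. Qed.
Let n_gt0 : 0 < n%:R :> R. Proof. by rewrite ltr0n; lia. Qed.
Let k_gt0R : 0 < k%:R :> R. Proof. by rewrite ltr0n; lia. Qed.
Let p_gt0 : 0 < p. Proof. by case/andP: p01. Qed.
Let p01' : 0 <= p <= 1. Proof. by case/andP: p01 => ? ?; rewrite !ltW. Qed.
Let pN_gt0 : 0 < p * N. Proof. exact: mulr_gt0. Qed.

Let K_nz A : A \in K -> A != set0.
Proof. by rewrite inE -card_gt0 => /eqP->. Qed.

Let disj_neq A B : A \in K -> disj A B -> A != B.
Proof. by move=> AK; apply: contraTneq => <-; rewrite /disj setIid K_nz. Qed.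

Let nbr A : hypergraph n := [set B in K | disj A B].

Let nbr_sub A : nbr A \subset K.
Proof. by apply/subsetP => B; rewrite inE => /andP[]. Qed.

Let card_nbr A : A \in K -> #|nbr A|%:R = D.
Proof. by rewrite card_ksets_disj inE => /eqP ->. Qed.

(** Chebyshev's inequality for the number of random edges through one vertex, the variance being at
    most the mean. *)
Lemma lower_star (eps : R) : 0 < eps ->
  1 - (eps ^+ 2 * (p * (k%:R / n%:R) * N))^-1 <=
  hyp_prob k p (fun H : hypergraph n =>
     (1 - eps) * (p * (k%:R / n%:R) * N) <= (max_intersecting H)%:R).
Proof.
move=> e0; set mu := p * (k%:R / n%:R) * N.
have v : 'I_n by apply: (@Ordinal n 0); lia.
pose S : hypergraph n := [set A in K | v \in A].
have sSK : S \subset K by apply/subsetP => A; rewrite inE => /andP[].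
have cS : #|S|%:R = k%:R / n%:R * N.
  have : (#|S| + 'C(n - 1, k) = 'C(n, k))%N.
    rewrite -(card_ksets n k) -[in RHS](cardsID S K) (setIidPr sSK); congr (_ + _)%N.
    rewrite -[1%N](cards1 v) -card_ksets_disj; apply: eq_card => A.
    rewrite !inE disj_disjoint disjoints1; case: (#|A| == k); rewrite ?andbF ?andbT //=.
  move=> e; have := @mul_bin_subn n k k_gt0; rewrite -e addnK.
  move=> /(congr1 (fun m : nat => m%:R : R)); rewrite !natrM e => {}e.
  by rewrite mulrAC -e mulrC mulKf ?gt_eqF.
have mu0 : 0 < mu by rewrite !mulr_gt0 ?invr_gt0.
have muE : p * #|S|%:R = mu by rewrite cS mulrA.
pose g H : R := (eps * mu) ^- 2 * (#|H :&: S|%:R - p * #|S|%:R) ^+ 2.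
apply: le_trans (_ : 1 - EX g <= _).
  rewrite lerD2l lerN2 expectZ.
  apply: le_trans (ler_wpM2l _ (expect_card_variance p01' sSK)) _.
    by rewrite invr_ge0 exprn_ge0 // mulr_ge0 ?(ltW mu0) ?ltW.
  by rewrite muE; apply: eq_ler; field; rewrite !gt_eqF.
apply: hyp_prob_ge => // H sHK; first by rewrite mulr_ge0 ?invr_ge0 ?sqr_ge0.
rewrite /g mulrC muE => /(sqr_div_lt1 (mulr_gt0 e0 mu0)) /andP[h _].
apply: le_trans (_ : #|H :&: S|%:R <= _); first by lra.
rewrite ler_nat max_intersecting_ge ?subsetIl //.
apply/intersectingP => A B; rewrite !inE => /andP[_ /andP[_ vA]] /andP[_ /andP[_ vB]].
by apply/set0Pn; exists v; rewrite inE vA.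
Qed.

Lemma expect_degsum : EX (fun H => degsum R (@disj n) H) = p ^+ 2 * N * D.
Proof.
rewrite (@eq_expect R _ K p _ (fun H => \sum_(A in K) \sum_(B in nbr A)
   ([set A; B] \subset H)%:R)); last first.
  move=> H sHK; rewrite /degsum big_mkcond [RHS]big_mkcond /=; apply: eq_bigr => A _.
  case: (boolP (A \in H)) => AH; last first.
    case: ifP => // _; rewrite big1 // => B _.
    by rewrite subUset sub1set (negbTE AH).
  rewrite (subsetP sHK _ AH) big_mkcond [RHS]big_mkcond /=; apply: eq_bigr => B _.
  rewrite inE subUset !sub1set AH /=.
  case: (boolP (B \in H)) => BH; last by case: ifP.
  by rewrite (subsetP sHK _ BH) /=; case: (disj A B).
rewrite expect_sum (eq_bigr (fun=> D * p ^+ 2)) => [|A AK].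
  by rewrite sumr_const card_ksets -[LHS]mulr_natl; ring.
rewrite expect_sum (eq_bigr (fun=> p ^+ 2)) => [|B].
  by rewrite sumr_const -[LHS]mulr_natl card_nbr.
rewrite inE => /andP[BK dAB]; rewrite expect_incl; last by rewrite subUset !sub1set AK.
by rewrite cards2 (disj_neq AK dAB).
Qed.

(** The expected number of ordered disjoint pairs is [p D] times [p N], negligible for small [p D].
    Each deleted edge has a disjoint partner, so at most [degsum] edges are lost; from above, [#|H|]
    itself suffices. *)
Lemma sparse_bounds (eps : R) : 0 < eps ->
  1 - (4 / (eps ^+ 2 * (p * N)) + 2 / eps * (p * D)) <= hyp_prob k p
    (fun H : hypergraph n => approx_eq eps (max_intersecting H)%:R (p * N)).
Proof.
move=> e0; pose l := eps / 2 * (p * N).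
have l0 : 0 < l by rewrite mulr_gt0 // divr_gt0.
(* Both failure events sit in one [g]: the summands are nonnegative, so [g H < 1] forces each of
   them below 1. *)
pose g H : R := l ^- 2 * (#|H :&: K|%:R - p * #|K|%:R) ^+ 2 + l^-1 * degsum R (@disj n) H.
have dg0 H : 0 <= degsum R (@disj n) H by do 2!apply: sumr_ge0 => ? _.
apply: le_trans (_ : 1 - EX g <= _).
  rewrite lerD2l lerN2 expectD !expectZ expect_degsum.
  apply: le_trans (lerD (ler_wpM2l _ (expect_card_variance p01' (subxx _))) (lexx _)) _.
    by rewrite invr_ge0 exprn_ge0 ?ltW.
  rewrite card_ksets /l; apply: eq_ler; field.
  by rewrite !gt_eqF.
apply: hyp_prob_ge => // H sHK.
  by rewrite addr_ge0 // mulr_ge0 ?sqr_ge0 ?invr_ge0 // ?exprn_ge0 ?ltW.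
rewrite /g card_ksets (setIidPl sHK) => g1.
have {}g1 : (#|H|%:R - p * N) ^+ 2 / l ^+ 2 < 1 /\ degsum R (@disj n) H < l.
  have a0 : 0 <= l ^- 2 * (#|H|%:R - p * N) ^+ 2.
    by rewrite mulr_ge0 ?sqr_ge0 ?invr_ge0 // exprn_ge0 // ltW.
  have b0 : 0 <= l^-1 * degsum R (@disj n) H by rewrite mulr_ge0 // invr_ge0 ltW.
  rewrite mulrC; split; first by lra.
  by rewrite -[ltRHS]mul1r -ltr_pdivrMr // mulrC; lra.
case: g1 => /(sqr_div_lt1 l0) /andP[h1 h2] h3.
pose S := [set A in H | [forall B in H, ~~ disj A B]].
have sSH : S \subset H by apply/subsetP => A; rewrite inE => /andP[].
have iS : intersecting S.
  apply/intersectingP => A B; rewrite !inE => /andP[AH /forall_inP dA] /andP[BH _].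
  exact: dA.
have cS : #|H|%:R - degsum R (@disj n) H <= #|S|%:R.
  rewrite lerBlDr -(cardsID S H) (setIidPr sSH) natrD lerD2l.
  rewrite -sum1_card natr_sum /degsum big_mkcond [leRHS]big_mkcond /=.
  apply: ler_sum => A _; rewrite !inE.
  case: (boolP (A \in H)) => AH; rewrite ?andbF //= andbT.
  case: ifP => [/forall_inPn[B BH /negPn dAB]|_]; last exact: sumr_ge0.
  by rewrite (bigD1 B) //= dAB lerDl sumr_ge0.
have := max_intersecting_ge sSH iS; rewrite -(ler_nat R) => lo.
have := max_intersecting_le H; rewrite -(ler_nat R) => hi.
rewrite /l in h1 h2 h3; rewrite /approx_eq; apply/andP; split; lra.
Qed.

(** * Shearer's bound in the random Kneser subgraph *)

Section TriangleFree.
Variables (F G : R -> R) (eta : R).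
Hypothesis G_le0 : forall x, 0 <= x -> G x <= 0.
Hypothesis tangent : forall x y, 0 <= x -> 0 <= y -> F x + G x * (y - x) <= F y.
Hypothesis ode : forall x, 0 <= x -> 0 <= 1 - (x + 1) * F x + G x * (x - x ^+ 2).
Hypothesis eta01 : 0 < eta < 1.
Local Notation y := (p * 'C(n - k, k)%:R).

Let y_gt0 : 0 < y. Proof. exact: mulr_gt0. Qed.
Let eta_gt0 : 0 < eta. Proof. by case/andP: eta01. Qed.

Let bad H := [set A in H | [exists B in H, [exists C in H,
  [&& disj A B, disj B C & disj A C]]]].

Let expect_bad : EX (fun H => #|bad H|%:R) <= p ^+ 3 * N * D * D2.
Proof.
apply: le_trans (_ : _ <= EX (fun H => \sum_(A in K) \sum_(B in nbr A)
   \sum_(C in nbr (A :|: B)) (C |: [set A; B] \subset H)%:R)) _.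
  apply: ler_expect => // H sHK.
  rewrite -sum1_card natr_sum big_mkcond [leRHS]big_mkcond /=.
  apply: ler_sum => A _; case: ifP => [|_]; last first.
    by case: ifP => // _; do 2!apply: sumr_ge0 => ? _.
  rewrite inE => /andP[AH /exists_inP[B BH /exists_inP[C CH /and3P[dAB dBC dAC]]]].
  rewrite (subsetP sHK _ AH) (bigD1 B) /=; last by rewrite inE (subsetP sHK _ BH).
  rewrite (bigD1 C) /=; last first.
    by rewrite inE (subsetP sHK _ CH) /disj setIUl setU_eq0 -/(disj A C) dAC.
  rewrite !subUset !sub1set AH BH CH -addrA lerDl.
  by rewrite addr_ge0 // sumr_ge0 // => ? _; apply: sumr_ge0.
rewrite expect_sum (eq_bigr (fun=> D * (D2 * p ^+ 3))) => [|A AK].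
  by rewrite sumr_const card_ksets -[leLHS]mulr_natl; apply: eq_ler; ring.
rewrite expect_sum (eq_bigr (fun=> D2 * p ^+ 3)) => [|B].
  by rewrite sumr_const -[LHS]mulr_natl card_nbr.
rewrite inE => /andP[BK dAB].
rewrite expect_sum (eq_bigr (fun=> p ^+ 3)) => [|C].
  rewrite sumr_const -[LHS]mulr_natl card_ksets_disj cardsU.
  move: AK BK dAB; rewrite !inE /disj => /eqP-> /eqP-> /eqP->.
  by rewrite cards0 subn0 addnn -mul2n.
rewrite inE => /andP[CK]; rewrite /disj setIUl setU_eq0 => /andP[dAC dBC].
rewrite expect_incl; last by rewrite !subUset !sub1set AK BK CK.
rewrite cardsU1 cards2 (disj_neq AK dAB) !inE negb_or.
by rewrite ![C == _]eq_sym (disj_neq AK dAC) (disj_neq BK dBC).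
Qed.

(** Measures the degrees of the present edges in mean square; Markov's inequality for the number of
    disjoint pairs alone would lose a constant factor. *)
Let W H : R := \sum_(A in K) (A \in H)%:R * (#|H :&: nbr A|%:R - y) ^+ 2.

Let expect_W : EX W <= p * N * y.
Proof.
rewrite expect_sum.
apply: le_trans (_ : _ <= \sum_(A in K) p * y) _; last first.
  by rewrite sumr_const card_ksets -[leLHS]mulr_natl; apply: eq_ler; ring.
apply: ler_sum => A AK.
have dA : [disjoint [set A] & nbr A].
  by rewrite disjoints1 inE AK /= /disj setIid K_nz.
have sA : [set A] \subset K by rewrite sub1set.
have := expect_incl_variance p01' sA (nbr_sub A) dA.
rewrite cards1 expr1 card_nbr //; apply: le_trans.
by apply: ler_expect => // H _; rewrite sub1set.
Qed.

(** The error terms are Chebyshev for the number of edges, Markov for the edges in triangles and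
    Markov for [W]. When none of these fails, [H :\: bad H] is triangle-free with nearly [p N]
    vertices and average degree at most about [y], and Shearer's bound is used at [x = y]. *)
Lemma lower_triangle_free : 0 <= F y ->
  1 - ((eta ^+ 2 * (p * N))^-1 + y ^+ 2 * (D2 / D) / eta + (4 * eta ^+ 2 * y)^-1)
  <= hyp_prob k p (fun H : hypergraph n =>
       p * N * ((1 - 4 * eta) * F y + 8 * eta * (y * G y)) <= (max_intersecting H)%:R).
Proof.
move=> F0; pose l := eta * (p * N).
have l0 : 0 < l by rewrite mulr_gt0.
pose m := 4 * eta ^+ 2 * y ^+ 2 * (p * N).
have m0 : 0 < m by rewrite !mulr_gt0 ?exprn_gt0.
pose g H : R := l ^- 2 * (#|H :&: K|%:R - p * #|K|%:R) ^+ 2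
   + (l^-1 * #|bad H|%:R + m^-1 * W H).
have W0 H : 0 <= W H by apply: sumr_ge0 => A _; rewrite mulr_ge0 ?sqr_ge0.
apply: le_trans (_ : 1 - EX g <= _).
  rewrite lerD2l lerN2 !expectD !expectZ.
  apply: le_trans (lerD (ler_wpM2l _ (expect_card_variance p01' (subxx _)))
    (lerD (ler_wpM2l _ expect_bad) (ler_wpM2l _ expect_W))) _.
  - by rewrite invr_ge0 exprn_ge0 ?ltW.
  - by rewrite invr_ge0 ?ltW.
  - by rewrite invr_ge0 ?ltW.
  rewrite card_ksets /l /m; apply: eq_ler; field.
  by rewrite !gt_eqF.
have a0 H : 0 <= l ^- 2 * (#|H :&: K|%:R - p * #|K|%:R) ^+ 2.
  by rewrite mulr_ge0 ?sqr_ge0 ?invr_ge0 // exprn_ge0 // ltW.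
have b0 H : 0 <= l^-1 * #|bad H|%:R by rewrite mulr_ge0 // invr_ge0 ltW.
have c0 H : 0 <= m^-1 * W H by rewrite mulr_ge0 // invr_ge0 ltW.
apply: hyp_prob_ge => // H sHK; first by rewrite !addr_ge0.
move=> g1; have [ga [gb gc]] : (#|H :&: K|%:R - p * #|K|%:R) ^+ 2 / l ^+ 2 < 1
    /\ #|bad H|%:R < l /\ W H < m.
  have := a0 H; have := b0 H; have := c0 H; rewrite /g in g1 => h1 h2 h3.
  split; first by rewrite mulrC; lra.
  by split; rewrite -[ltRHS]mul1r -ltr_pdivrMr // mulrC; lra.
move: ga; rewrite card_ksets (setIidPl sHK) => /(sqr_div_lt1 l0) /andP[h1 h2].
pose S := H :\: bad H.
have sSH : S \subset H by rewrite subsetDl.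
have badH : bad H \subset H by apply/subsetP => A; rewrite inE => /andP[].
have cS : #|S|%:R = #|H|%:R - #|bad H|%:R :> R.
  by rewrite cardsD (setIidPr badH) natrB // subset_leq_card.
have degS : degsum R (@disj n) S <= (1 + 4 * eta) * y * (p * N).
  apply: (@le_trans _ _ (\sum_(A in K) (A \in H)%:R * #|H :&: nbr A|%:R)).
    rewrite /degsum big_mkcond [leRHS]big_mkcond /=; apply: ler_sum => A _.
    case: (boolP (A \in S)) => AS; last by case: ifP => // _; rewrite mulr_ge0.
    have AH := subsetP sSH _ AS; rewrite (subsetP sHK _ AH) AH mul1r sum_adj_card ler_nat.
    apply: subset_leq_card; apply/subsetP => B; rewrite !inE => /andP[/andP[_ BH] dAB].
    by rewrite BH dAB /= andbT; have := subsetP sHK _ BH; rewrite inE.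
  apply: (@le_trans _ _ ((1 + eta) * y * #|H|%:R + (4 * eta * y)^-1 * W H)).
    have -> : #|H|%:R = \sum_(A in K) (A \in H)%:R :> R.
      by rewrite -cardI_sum (setIidPl sHK).
    rewrite /W !mulr_sumr -big_split /=; apply: ler_sum => A _.
    case: (A \in H); rewrite ?mul0r ?mulr0 ?addr0 // !mul1r mulr1.
    set d : R := #|_|%:R; pose z := d - y.
    (* AM-GM in the form [d <= (1 + eta) y + (d - y)^2 / (4 eta y)]: the total degree is controlled
       without concentration of each single degree. *)
    rewrite -subr_ge0 (_ : _ - d = (4 * eta * y)^-1 * (z - 2 * eta * y) ^+ 2).
      by rewrite mulr_ge0 ?sqr_ge0 // invr_ge0 !mulr_ge0 // ltW.
    by rewrite /z; field; rewrite !gt_eqF.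
  have w1 : (4 * eta * y)^-1 * W H <= eta * y * (p * N).
    rewrite mulrC ler_pdivrMr ?mulr_gt0 //.
    by apply: le_trans (ltW gc) _; rewrite /m; apply: eq_ler; ring.
  have w2 : (1 + eta) * y * #|H|%:R <= (1 + eta) * y * ((1 + eta) * (p * N)).
    apply: ler_wpM2l; last by rewrite /l in h2; lra.
    by rewrite mulr_ge0 ?(ltW y_gt0) // addr_ge0 // ltW.
  have w3 : (1 + eta) * y * ((1 + eta) * (p * N)) <= (1 + 3 * eta) * (y * (p * N)).
    rewrite mulrACA; apply: ler_wpM2r; first exact: ltW (mulr_gt0 y_gt0 pN_gt0).
    by case/andP: eta01 => ? ?; nra.
  lra.
have irrS : {in S, forall A, disj A A = false}.
  by move=> A /(subsetP sSH)/(subsetP sHK)/K_nz; rewrite /disj setIid => /negbTE.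
have tfS : {in S & S & S, forall A B C, disj A B -> disj B C -> ~~ disj A C}.
  move=> A B C AS /(subsetP sSH) BH /(subsetP sSH) CH dAB dBC; apply/negP => dAC.
  move: AS; rewrite in_setD => /andP[/negP nbad AH]; apply: nbad.
  rewrite inE AH; apply/exists_inP; exists B => //; apply/exists_inP; exists C => //.
  by rewrite dAB dBC dAC.
have [I [sIS iI leI]] := shearer (@disj_sym n) G_le0 tangent ode irrS tfS.
have := max_intersecting_ge (subset_trans sIS sSH) (introT (intersectingP _) iI).
rewrite -(ler_nat R); apply: le_trans; apply: le_trans (leI _ (ltW y_gt0)).
have G0 := G_le0 (ltW y_gt0).
have S1 : (1 - 2 * eta) * (p * N) <= #|S|%:R by rewrite cS; rewrite /l in h1 gb; lra.
have t1 : G y * ((1 + 4 * eta) * y * (p * N)) <= G y * degsum R (@disj n) S.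
  by rewrite ler_wnM2l.
(* The signs [G y <= 0] and [F y - y * G y >= 0] are known; lowering [1 - 2 eta] to [1 - 4 eta] lets
   the terms collect to [8 eta]. *)
have t2 : (F y - y * G y) * ((1 - 4 * eta) * (p * N)) <= (F y - y * G y) * #|S|%:R.
  have FG0 : 0 <= F y - y * G y by rewrite subr_ge0 (le_trans _ F0) // mulr_ge0_le0 // ltW.
  rewrite ler_wpM2l //; apply: le_trans S1; rewrite ler_wpM2r ?(ltW pN_gt0) //.
  by case/andP: eta01 => ? ?; lra.
move: t1 t2; set Gy := G y; set Fy := F y; set dg := degsum _ _ _; set s : R := #|S|%:R.
by move=> t1 t2; lra.
Qed.

End TriangleFree.
End LowerBounds.

From mathcomp Require Import all_classical all_reals all_analysis.
Import Order.TTheory GRing.Theory Num.Theory.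
Import numFieldNormedType.Exports.
Local Open Scope classical_set_scope.
Local Open Scope ring_scope.

(** * A convex solution of Shearer's differential inequality *)

Section ShearerFunction.
Variable R : realType.
Implicit Types (t s x y z u : R).

Lemma le_of_derive_ge0 (f df : R -> R) (a b : R) : a <= b ->
  (forall x, a <= x -> is_derive x 1 f (df x)) ->
  (forall x, a <= x -> 0 <= df x) -> f a <= f b.
Proof.
move=> ab fdf df0.
have [x||c] := @MVT_segment R f df a b ab.
- by rewrite in_itv /= => /andP[/ltW ax _]; apply: fdf.
- apply: derivable_within_continuous => x; rewrite in_itv /= => /andP[ax _].
  by apply: ex_derive; apply: fdf.
rewrite in_itv /= => /andP[ac _] e; rewrite -subr_ge0 e mulr_ge0 ?subr_ge0 //.
exact: df0.
Qed.

(** The difference of the sides vanishes at 1 and has derivative [(x - 1)^2 / x]. *)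
Lemma ln_ge_quadratic z : 1 <= z -> (z - 1) * (3 - z) / 2 <= ln z.
Proof.
move=> z1; rewrite -subr_ge0.
have := @le_of_derive_ge0 (fun x => ln x - (x - 1) * (3 - x) / 2)
  (fun x => x^-1 + x - 2) 1 z z1.
rewrite ln1 subrr !mul0r subrr; apply => x x1; have x0 : 0 < x by lra.
  have d := is_derive1_ln x0.
  by apply: is_derive_eq; rewrite /GRing.scale /=; lra.
have : 0 <= x^-1 * (x - 1) ^+ 2 by rewrite mulr_ge0 ?sqr_ge0 // invr_ge0 ltW.
have -> : x^-1 * (x - 1) ^+ 2 = x^-1 + x - 2 by field; rewrite gt_eqF.
by [].
Qed.

(** With [z = exp (- t)] this is [t <= sinh t] for [t >= 0]. *)
Lemma ln_le_sinh z : 0 < z <= 1 -> - ln z <= (z^-1 - z) / 2.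
Proof.
move=> /andP[z0 z1]; pose t := - ln z.
have t0 : 0 <= t by rewrite oppr_ge0 ln_le0.
have zE : z = expR (- t) by rewrite opprK lnK.
have zVE : z^-1 = expR t by rewrite zE expRN invrK.
have := @le_of_derive_ge0 (fun x => expR x - expR (- x) - x *+ 2)
  (fun x => expR x + expR (- x) - 2) 0 t t0.
rewrite oppr0 subrr mul0rn subrr -zE -zVE -/t => h; suff : 0 <= z^-1 - z - t *+ 2 by lra.
apply: h => x x0.
  apply: is_derive_eq; rewrite /GRing.scale /=; lra.
have e0 := expR_gt0 x.
have : 0 <= (expR x)^-1 * (expR x - 1) ^+ 2 by rewrite mulr_ge0 ?sqr_ge0 // invr_ge0 ltW.
have -> : (expR x)^-1 * (expR x - 1) ^+ 2 = expR x + expR (- x) - 2.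
  by rewrite expRN; field; rewrite gt_eqF.
by [].
Qed.

(* The differential inequality is nearly an equality for [(ln t + a) / t], which is
   convex only for [t >= expR (3/2 - a)]; with [a = 3/2] its tangent at [1] extends
   it to a convex function that still satisfies the inequality on [[0, 1]]. *)
Definition phi t : R := if t < 1 then 2 - t / 2 else (ln t + 3 / 2) / t.
Definition dphi t : R := if t < 1 then - (1 / 2) else - (ln t + 1 / 2) / t ^+ 2.

Lemma dphi_bounds t : 0 <= t -> - (1 / 2) <= dphi t <= 0.
Proof.
move=> t0; rewrite /dphi; case: ltrP => [|t1]; first by lra.
have l0 : 0 <= ln t by rewrite ln_ge0.
have tp : 0 < t by lra.
have l1 := ln_le_subr1 tp.
apply/andP; split; first by rewrite ler_pdivlMr ?exprn_gt0 //; nra.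
by rewrite mulNr oppr_le0 divr_ge0 ?sqr_ge0 //; lra.
Qed.

(** With [z = t / s], the difference of the sides is the expression in [key] divided by [t]. For
    [z >= 1] the quadratic bound on [ln z] suffices; for [z < 1], [t >= 1] gives [ln s >= - ln z],
    and [ln_le_sinh] finishes. *)
Lemma phi_tangent_large s t : 1 <= s -> 1 <= t ->
  (ln s + 3 / 2) / s - (ln s + 1 / 2) / s ^+ 2 * (t - s) <= (ln t + 3 / 2) / t.
Proof.
move=> s1 t1; have s0 : 0 < s by lra. have t0 : 0 < t by lra.
pose z := t / s; have z0 : 0 < z by rewrite divr_gt0.
have tE : t = z * s by rewrite /z divfK ?gt_eqF.
have lt : ln t = ln z + ln s by rewrite tE lnM.
have ls0 : 0 <= ln s by rewrite ln_ge0.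
have key : 0 <= ln z + ln s * (z - 1) ^+ 2 + (z - 1) * (z - 3) / 2.
  have [z1|z1] := lerP 1 z.
    have := ln_ge_quadratic z1; have : 0 <= ln s * (z - 1) ^+ 2 by rewrite mulr_ge0 ?sqr_ge0.
    lra.
  have lsz : - ln z <= ln s by have := ln_ge0 t1; rewrite lt; lra.
  have : - ln z * (z - 1) ^+ 2 <= ln s * (z - 1) ^+ 2 by rewrite ler_wpM2r ?sqr_ge0.
  have := @ln_le_sinh z; rewrite z0 ltW // => /(_ isT) h1 h2.
  have h3 : - ln z * (1 - (z - 1) ^+ 2) <= (z^-1 - z) / 2 * (1 - (z - 1) ^+ 2).
    rewrite ler_wpM2r //; nra.
  have h4 : (z^-1 - z) / 2 * (1 - (z - 1) ^+ 2) <= (z - 1) * (z - 3) / 2.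
    have -> : (z^-1 - z) / 2 * (1 - (z - 1) ^+ 2) = (1 - z) * (1 + z) * (2 - z) / 2.
      by field; rewrite gt_eqF.
    have : 0 <= (1 - z) * (z - 1) ^+ 2 by rewrite mulr_ge0 ?sqr_ge0 // subr_ge0 ltW.
    lra.
  lra.
rewrite -subr_ge0.
have -> : (ln t + 3 / 2) / t - ((ln s + 3 / 2) / s - (ln s + 1 / 2) / s ^+ 2 * (t - s)) =
   (ln z + ln s * (z - 1) ^+ 2 + (z - 1) * (z - 3) / 2) / t.
  by rewrite lt tE; field; rewrite !gt_eqF.
by rewrite divr_ge0 // ltW.
Qed.

(** Across the joint at 1 the branches are compared with their common tangent there, of slope
    [- 1 / 2]. *)
Lemma phi_tangent s t : 0 <= s -> 0 <= t -> phi s + dphi s * (t - s) <= phi t.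
Proof.
move=> s0 t0.
have P1 : (ln 1 + 3 / 2) / 1 = 3 / 2 :> R by rewrite ln1 divr1 add0r.
have := dphi_bounds s0; rewrite /phi /dphi.
case: (ltrP s 1) => s1; case: (ltrP t 1) => t1 b.
- lra.
- have := @phi_tangent_large 1 t (lexx _) t1; rewrite P1 ln1 expr1n; lra.
- have := @phi_tangent_large s 1 s1 (lexx _); rewrite P1; nra.
- have := phi_tangent_large s1 t1; lra.
Qed.

(** This is [ode] for [phi (x / u) / (u + 2)] at [x = u t], multiplied by [(u + 2) / u]. For
    [t >= 1] the excess over 1 is [(2 / u) (ln t + 1) / t], which the divisor [u + 2] absorbs. *)
Lemma phi_ode u t : 0 < u -> 0 <= t ->
  (t + u^-1) * phi t - dphi t * (t / u - t ^+ 2) <= 1 + 2 / u.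
Proof.
move=> u0 t0; have v0 : 0 < u^-1 by rewrite invr_gt0.
rewrite /phi /dphi; case: ltrP => t1; first by nra.
have tp : 0 < t by lra.
have -> : (t + u^-1) * ((ln t + 3 / 2) / t)
    - - (ln t + 1 / 2) / t ^+ 2 * (t / u - t ^+ 2) = 1 + 2 / u * ((ln t + 1) / t).
  by field; rewrite !gt_eqF.
rewrite lerD2l; apply: ler_piMr; first by rewrite ltW ?divr_gt0.
rewrite ler_pdivrMr // mul1r.
by have := ln_le_subr1 tp; lra.
Qed.

End ShearerFunction.

(** * Exponential bounds on binomial quotients, and case (2) for fixed [n] *)

Lemma bin_sub_le (R : realType) (m k j : nat) : (0 < m)%N -> (k <= m)%N ->
  'C(m - k, j)%:R <= expR (- (j%:R * (k%:R / m%:R))) * 'C(m, j)%:R :> R.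
Proof.
move=> m0 km; have m0R : 0 < m%:R :> R by rewrite ltr0n.
elim: j => [|j IH]; first by rewrite !bin0 mul0r oppr0 expR0 mulr1.
have [jm|mj] := leqP j m; last first.
  by rewrite [X in X%:R <= _]bin_small ?mulr_ge0 ?expR_ge0 //; lia.
have j0 : 0 < j.+1%:R :> R by rewrite ltr0n.
have binE i : j.+1%:R * 'C(i, j.+1)%:R = (i - j)%:R * 'C(i, j)%:R :> R.
  by rewrite -!natrM mul_bin_left.
rewrite -(ler_pM2l j0) binE [leRHS]mulrCA binE -natr1 mulrDl mul1r opprD expRD.
(* Each further factor of the quotient is [(m - k - j) / (m - j) <= 1 - k / m]. *)
have h : (m - k - j)%:R <= expR (- (k%:R / m%:R)) * (m - j)%:R :> R.
  apply: (@le_trans _ _ ((1 - k%:R / m%:R) * (m - j)%:R)); last first.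
    by rewrite ler_wpM2r // expR_ge1Dx.
  have km1 : k%:R / m%:R <= 1 :> R by rewrite ler_pdivrMr // mul1r ler_nat.
  have [kj|kj] := leqP (m - k) j.
    by rewrite (eqP kj) mulr_ge0 ?subr_ge0.
  rewrite (natrB _ (ltnW kj)) (natrB _ km) (natrB _ jm) mulrBl mul1r mulrBr divfK ?gt_eqF //.
  have : 0 <= k%:R / m%:R * j%:R :> R by rewrite mulr_ge0 // divr_ge0.
  lra.
apply: (@le_trans _ _ ((expR (- (k%:R / m%:R)) * (m - j)%:R) *
   (expR (- (j%:R * (k%:R / m%:R))) * 'C(m, j)%:R))).
  exact: ler_pM.
by apply: eq_ler; ring.
Qed.

Section FiniteLower.
Variables (R : realType) (n k : nat) (p : R).
Hypotheses (k_gt0 : (0 < k)%N) (le2kn : (2 * k <= n)%N) (p01 : 0 < p < 1).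
Local Notation N := ('C(n, k)%:R : R).
Local Notation D := ('C(n - k, k)%:R : R).
Local Notation D2 := ('C(n - 2 * k, k)%:R : R).
Local Notation Q := ('C(n, k)%:R / 'C(n - k, k)%:R : R).
Local Notation r := (n%:R / k%:R : R).
Local Notation y := (p * 'C(n - k, k)%:R).

Let N_gt0 : 0 < N. Proof. by rewrite ltr0n bin_gt0; lia. Qed.
Let D_gt0 : 0 < D. Proof. by rewrite ltr0n bin_gt0; lia. Qed.
Let n_gt0 : 0 < n%:R :> R. Proof. by rewrite ltr0n; lia. Qed.
Let k_gt0R : 0 < k%:R :> R. Proof. by rewrite ltr0n; lia. Qed.
Let p_gt0 : 0 < p. Proof. by case/andP: p01. Qed.

(** In fact [Q >= exp (k^2 / n)]. This makes the mean size of a random star grow even while [n / k]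
    stays bounded. *)
Lemma quot_ge : 1 + k%:R ^+ 2 / n%:R <= Q.
Proof.
apply: le_trans (expR_ge1Dx _) _; rewrite ler_pdivlMr //.
have h0 : (0 < n)%N by lia.
have hk : (k <= n)%N by lia.
have := @bin_sub_le R n k k h0 hk.
by rewrite mulrA -expr2 expRN ler_pdivlMl ?expR_gt0.
Qed.

(** [D2 / D] is the chance that a k-set disjoint from one edge also avoids a second edge disjoint
    from the first; its smallness makes triangles rare. *)
Lemma codegree_le : D2 / D <= expR (- (k%:R ^+ 2 / n%:R)).
Proof.
rewrite ler_pdivrMr // mul2n -addnn subnDA.
apply: le_trans (@bin_sub_le R (n - k) k k _ _) _; [lia|lia|].
rewrite ler_wpM2r // ler_expR lerN2 expr2 -mulrA ler_wpM2l // ler_wpM2l //.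
by rewrite lef_pV2 ?posrE ?ltr0n ?ler_nat; lia.
Qed.

(** [F] and [G] are [phi] and its derivative stretched by [u], divided by [u + 2] to satisfy [ode].
    As [p N = Q y], the bound [p N F y] is about [Q ln y]. *)
Lemma lower_sparse (eps : R) : 0 < eps < 1 -> 8 / eps <= y ->
  4 / eps * ln (8 / eps) <= ln y -> y <= r -> 4 * n%:R * ln n%:R <= k%:R ^+ 2 :> R ->
  1 - 3 / ((eps / 48) ^+ 2 * y) <= hyp_prob k p (fun H : hypergraph n =>
    (1 - eps) * Q * ln y <= (max_intersecting H)%:R).
Proof.
move=> /andP[e0 e1] uy lnuy yr kn.
(* Three factors [1 - eps / 4] are lost: in [u / (u + 2)], in [ln (y / u)] against [ln y], and in
   [1 - 12 eta], where [12 = 4 + 8] comes from [lower_triangle_free]. *)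
set u := 8 / eps in uy lnuy; set eta := eps / 48.
have u0 : 0 < u by rewrite divr_gt0.
have u8 : 8 <= u by rewrite ler_pdivlMr //; lra.
have y0 : 0 < y by lra.
have eta0 : 0 < eta by rewrite divr_gt0.
have eta01 : 0 < eta < 1 by rewrite eta0 /eta; lra.
pose F x := phi (x / u) / (u + 2); pose G x := dphi (x / u) / (u * (u + 2)).
have u2 : 0 < u + 2 by lra.
have xu (x : R) : 0 <= x -> 0 <= x / u by move=> x0; rewrite divr_ge0 // ltW.
have G_le0 x : 0 <= x -> G x <= 0.
  move=> /xu /dphi_bounds /andP[_ h].
  by rewrite /G mulr_le0_ge0 // invr_ge0 ltW // mulr_gt0.
have tangent x z : 0 <= x -> 0 <= z -> F x + G x * (z - x) <= F z.
  move=> /xu x0 /xu z0; have := phi_tangent x0 z0; rewrite /F /G => h.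
  rewrite -(ler_pM2r u2) divfK ?gt_eqF //; apply: le_trans h.
  by apply: eq_ler; field; rewrite !gt_eqF.
have ode x : 0 <= x -> 0 <= 1 - (x + 1) * F x + G x * (x - x ^+ 2).
  move=> /xu x0; have := phi_ode u0 x0; rewrite -subr_ge0 => h.
  rewrite -(pmulr_rge0 _ (_ : 0 < (u + 2) / u)) ?divr_gt0 //.
  apply: le_trans h _; rewrite /F /G; apply: eq_ler; field.
  by rewrite !gt_eqF.
have yu1 : 1 <= y / u by rewrite ler_pdivlMr // mul1r.
have l0 : 0 <= ln (y / u) by rewrite ln_ge0.
have FyE : F y = (ln (y / u) + 3 / 2) * u / ((u + 2) * y).
  by rewrite /F /phi ltNge yu1 /=; field; rewrite !gt_eqF.
have GyE : y * G y = - (ln (y / u) + 1 / 2) * u / ((u + 2) * y).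
  by rewrite /G /dphi ltNge yu1 /=; field; rewrite !gt_eqF.
have F0 : 0 <= F y.
  rewrite FyE; apply: divr_ge0; last by rewrite ltW // mulr_gt0.
  by apply: mulr_ge0; [lra|exact: ltW].
have := lower_triangle_free k_gt0 le2kn p01 G_le0 tangent ode eta01 F0.
move=> tail; apply: le_trans (le_trans tail _); last first.
  apply: hyp_prob_mono; first by case/andP: p01 => ? ?; rewrite !ltW.
  move=> H; apply: le_trans; rewrite FyE GyE.
  have pNE : p * N = Q * y by field; rewrite gt_eqF.
  have -> : p * N * ((1 - 4 * eta) * ((ln (y / u) + 3 / 2) * u / ((u + 2) * y)) +
      8 * eta * (- (ln (y / u) + 1 / 2) * u / ((u + 2) * y))) =
      Q * (((1 - 12 * eta) * ln (y / u) + (3 / 2 - 10 * eta)) * (u / (u + 2))).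
    by rewrite pNE; field; rewrite !gt_eqF.
  rewrite -mulrA mulrCA; apply: ler_wpM2l; first by rewrite divr_ge0.
  have lnE : ln (y / u) = ln y - ln u by rewrite ln_div.
  have lnu : ln u <= eps / 4 * ln y.
    have := ler_wpM2l (_ : 0 <= eps / 4) lnuy; rewrite divr_ge0 ?(ltW e0) // => /(_ isT).
    by apply: le_trans; apply: eq_ler; field; rewrite gt_eqF.
  have lnu0 : 0 <= ln u by rewrite ln_ge0 //; lra.
  have lny0 : 0 <= ln y by rewrite ln_ge0 //; lra.
  have cE : 1 - eps / 4 <= u / (u + 2).
    rewrite ler_pdivlMr //.
    have : eps * u = 8 by rewrite /u mulrC divfK ?gt_eqF.
    lra.
  apply: (@le_trans _ _ (((1 - eps / 4) * ((1 - eps / 4) * ln y)) * (1 - eps / 4))).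
    have -> : (1 - eps / 4) * ((1 - eps / 4) * ln y) * (1 - eps / 4)
        = (1 - eps / 4) ^+ 3 * ln y by ring.
    rewrite ler_wpM2r //.
    have : 0 <= eps ^+ 2 * (1 - eps) by rewrite mulr_ge0 ?sqr_ge0 //; lra.
    have : 0 <= eps ^+ 2 := sqr_ge0 _.
    lra.
  apply: ler_pM => //; rewrite ?mulr_ge0 //; try lra.
  apply: (@le_trans _ _ ((1 - 12 * eta) * ln (y / u))); last by rewrite lerDl /eta; lra.
  by rewrite (_ : 1 - 12 * eta = 1 - eps / 4); [rewrite ler_wpM2l //; lra|rewrite /eta; field].
rewrite lerD2l lerN2.
have NyD : y <= p * N by rewrite ler_pM2l // ler_nat leq_bin2l // leq_subr.
have a1 : (eta ^+ 2 * (p * N))^-1 <= (eta ^+ 2 * y)^-1.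
  by rewrite lef_pV2 ?posrE ?mulr_gt0 ?exprn_gt0 // ler_wpM2l ?sqr_ge0.
have ey0 : 0 < eta ^+ 2 * y by rewrite mulr_gt0 ?exprn_gt0.
have a3 : (4 * eta ^+ 2 * y)^-1 <= (eta ^+ 2 * y)^-1.
  rewrite -mulrA lef_pV2 ?posrE //; last exact: mulr_gt0.
  by apply: ler_peMl; [exact: ltW|lra].
have yn : y <= n%:R.
  apply: le_trans yr _; rewrite ler_pdivrMr // ler_peMr // ?(ltW n_gt0) // ler1n //.
have a2 : y ^+ 2 * (D2 / D) / eta <= (eta ^+ 2 * y)^-1.
  have n1 : 1 <= n%:R :> R by rewrite ler1n -(ltr0n R).
  (* The exponent is the 4 of [4 n ln n <= k^2]. With [y <= n] it bounds [y ^+ 2 * (D2 / D)] by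
     [n ^- 2], hence by [1 / y]. *)
  have Dn : D2 / D <= n%:R ^- 4.
    apply: le_trans codegree_le _.
    have -> : n%:R ^- 4 = expR (- (4%:R * ln n%:R)) :> R.
      by rewrite expRN expRM_natl lnK ?posrE.
    by rewrite ler_expR lerN2 ler_pdivlMr // mulrAC.
  have b1 : y ^+ 2 * (D2 / D) <= n%:R ^+ 2 * n%:R ^- 4.
    by rewrite ler_pM ?sqr_ge0 ?divr_ge0 // lerXn2r ?nnegrE ?(ltW y0) ?(ltW n_gt0).
  have b2 : n%:R ^+ 2 * n%:R ^- 4 <= n%:R^-1 :> R.
    have -> : n%:R ^+ 2 * n%:R ^- 4 = n%:R^-1 * n%:R^-1 :> R by field; rewrite gt_eqF.
    by rewrite ler_piMr ?invr_ge0 ?(ltW n_gt0) // invf_le1.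
  have b3 : n%:R^-1 <= y^-1 by rewrite lef_pV2 ?posrE.
  have b4 : y ^+ 2 * (D2 / D) <= y^-1 by apply: le_trans b1 (le_trans b2 b3).
  apply: (@le_trans _ _ (y^-1 / eta)); first by rewrite ler_pM2r ?invr_gt0.
  rewrite -invfM lef_pV2 ?posrE ?mulr_gt0 ?exprn_gt0 // mulrC ler_pM2l // expr2.
  by rewrite ler_piMl //; case/andP: eta01 => ? ?; lra.
apply: le_trans (lerD (lerD a1 a2) a3) _.
by rewrite [leRHS]mulr_natl !mulrS mulr0n addr0 addrA.
Qed.

End FiniteLower.

(** * Asymptotics *)

Section Asymptotics.
Variable R : realType.

Lemma much_less_lt (a b : nat -> R) (e : R) : 0 < e -> much_less a b ->
  \forall n \near \oo, a n / b n < e.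
Proof.
move=> e0 /cvgr0_norm_lt /(_ e e0); apply: filterS => n.
exact: le_lt_trans (ler_norm _).
Qed.

Lemma much_less_inv_gt (D p : nat -> R) (M : R) :
  (\forall n \near \oo, 0 < p n < 1) -> (\forall n \near \oo, 0 < D n) ->
  much_less (fun n => (D n)^-1) p -> \forall n \near \oo, M < p n * D n.
Proof.
move=> hp hD ml; have M0 : 0 < `|M| + 1 by rewrite ltr_wpDl.
have e0 : 0 < (`|M| + 1)^-1 by rewrite invr_gt0.
near=> n.
have D0 : 0 < D n by near: n.
have /andP[p0 _] : 0 < p n < 1 by near: n.
have : (D n)^-1 / p n < (`|M| + 1)^-1 by near: n; apply: much_less_lt.
rewrite -invfM mulrC ltf_pV2 ?posrE ?mulr_gt0 //; apply: lt_trans.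
by rewrite (le_lt_trans (ler_norm _)) // ltrDl.
Unshelve. all: by end_near. Qed.

Lemma aasP (k : nat -> nat) (p : nat -> R) (E : forall n, hypergraph n -> bool) :
  (\forall n \near \oo, 0 < p n < 1) ->
  (forall d : R, 0 < d -> \forall n \near \oo, 1 - d <= hyp_prob (k n) (p n) (E n)) ->
  aas k p E.
Proof.
move=> hp hE; apply/cvgrPdist_le => d d0; near=> n.
have /andP[p0 p1] : 0 < p n < 1 by near: n.
have le1 : hyp_prob (k n) (p n) (E n) <= 1 by apply: hyp_prob_le1; rewrite !ltW.
rewrite ger0_norm ?subr_ge0 // lerBlDr -lerBlDl.
by near: n; apply: hE.
Unshelve. all: by end_near. Qed.

Lemma hyp_prob_and (n k : nat) (p : R) (E1 E2 : hypergraph n -> bool) :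
  0 <= p <= 1 ->
  hyp_prob k p E1 + hyp_prob k p E2 - 1 <= hyp_prob k p (fun H => E1 H && E2 H).
Proof.
move=> p01; rewrite lerBlDr -[X in _ <= _ + X](expect_cst (ksets n k) p 1) /hyp_prob.
rewrite big_mkcondr [X in _ + X <= _]big_mkcondr [X in _ <= X + _]big_mkcondr.
rewrite -!big_split /=; apply: ler_sum => H _; rewrite mulr1.
have := bwt_ge0 (ksets n k) p01 H; rewrite -/(hyp_weight k p H) => w0.
by case: (E1 H); case: (E2 H); rewrite /= ?addr0 ?add0r ?lerDl ?addr_ge0.
Qed.

Lemma near_ge_nat (M : R) : \forall n \near \oo, M <= n%:R.
Proof. exact: nbhs_infty_ger. Qed.

Variables (eps : R) (p : nat -> R) (k : nat -> nat).
Hypothesis heps : 0 < eps < 1.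
Hypothesis hp : \forall n \near \oo, 0 < p n < 1.
Hypothesis hk : \forall n \near \oo, (2 <= k n)%N /\ ((k n)%:R : R) <= n%:R / 2.
Let N : nat -> R := fun n => ('C(n, k n))%:R.
Let D : nat -> R := fun n => ('C(n - k n, k n))%:R.
Let r : nat -> R := fun n => n%:R / (k n)%:R.

Let hk' : \forall n \near \oo, (0 < k n)%N /\ (2 * k n <= n)%N.
Proof.
apply: filterS hk => n [k2 kn]; split; first by lia.
by rewrite -(ler_nat R) natrM; lra.
Qed.

Let hN : \forall n \near \oo, 0 < N n.
Proof. by apply: filterS hk' => n [k0 kn]; rewrite ltr0n bin_gt0; lia. Qed.

Let hD : \forall n \near \oo, 0 < D n.
Proof. by apply: filterS hk' => n [k0 kn]; rewrite ltr0n bin_gt0; lia. Qed.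

Lemma aas_very_sparse :
  much_less (fun n => (N n)^-1) p -> much_less p (fun n => (D n)^-1) ->
  aas k p (fun n H => approx_eq eps (max_intersecting H)%:R (p n * N n)).
Proof.
have /andP[e0 e1] := heps.
move=> hpN hpD; apply: aasP => // d d0; near=> n.
have [k0 kn] : (0 < k n)%N /\ (2 * k n <= n)%N by near: n.
have p01 : 0 < p n < 1 by near: n.
apply: le_trans (sparse_bounds k0 kn p01 e0); rewrite lerD2l lerN2.
have pN : 8 / (eps ^+ 2 * d) < p n * N n by near: n; exact: much_less_inv_gt.
have pD : p n * D n < d * eps / 4.
  have : p n / (D n)^-1 < d * eps / 4.
    by near: n; apply: much_less_lt => //; rewrite divr_gt0 ?mulr_gt0.
  by rewrite invrK.
have c0 : 0 < 8 / (eps ^+ 2 * d) by rewrite divr_gt0 ?mulr_gt0 ?exprn_gt0.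
have pN0 : 0 < p n * N n by lra.
have h1 : 4 / (eps ^+ 2 * (p n * N n)) <= d / 2.
  rewrite ler_pdivrMr; last by rewrite mulr_gt0 // exprn_gt0.
  move: pN; rewrite ltr_pdivrMr; last by rewrite mulr_gt0 // exprn_gt0.
  by move=> h; lra.
have h2 : 2 / eps * (p n * D n) <= d / 2.
  by rewrite mulrAC ler_pdivrMr //; lra.
by have := lerD h1 h2; rewrite -splitr.
Unshelve. all: by end_near. Qed.

Lemma aas_sparse_lower :
  much_less (fun n => (D n)^-1) p ->
  (\forall n \near \oo, p n <= r n * (D n)^-1) ->
  much_less (fun n => Num.sqrt (n%:R * ln n%:R) : R) (fun n => (k n)%:R : R) ->
  aas k p (fun n H =>
    (1 - eps) * (N n / D n) * ln (p n * D n) <= (max_intersecting H)%:R).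
Proof.
have /andP[e0 e1] := heps.
move=> hpD hpr hks; apply: aasP => // d d0; near=> n.
have [k0 kn] : (0 < k n)%N /\ (2 * k n <= n)%N by near: n.
have p01 : 0 < p n < 1 by near: n.
have D0 : 0 < D n by near: n.
have y1 : 8 / eps < p n * D n by near: n; exact: much_less_inv_gt.
have y2 : expR (4 / eps * ln (8 / eps)) < p n * D n by near: n; exact: much_less_inv_gt.
have y3 : 3 / ((eps / 48) ^+ 2 * d) < p n * D n by near: n; exact: much_less_inv_gt.
have pr : p n <= r n * (D n)^-1 by near: n.
(* The ratio 1/2 squares to [4 n ln n <= k^2]. *)
have ks : Num.sqrt (n%:R * ln n%:R) / (k n)%:R < 1 / 2 :> R.
  by near: n; apply: much_less_lt.
have y0 : 0 < p n * D n by apply: le_lt_trans y2; exact: expR_ge0.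
have eta0 : 0 < (eps / 48) ^+ 2 by rewrite exprn_gt0 // divr_gt0.
apply: le_trans (lower_sparse k0 kn p01 heps (ltW y1) _ _ _).
- rewrite lerD2l lerN2 ler_pdivrMr; last exact: mulr_gt0.
  by move: y3; rewrite ltr_pdivrMr ?mulr_gt0 // => h; lra.
- by rewrite -ler_expR lnK ?posrE // ltW.
- by rewrite -ler_pdivlMr.
- have k0R : 0 < (k n)%:R :> R by rewrite ltr0n.
  have nl : 0 <= n%:R * ln n%:R :> R.
    by rewrite mulr_ge0 // ln_ge0 // ler1n (leq_trans _ kn) // muln_gt0.
  move: ks; rewrite ltr_pdivrMr // => ks.
  have := sqr_sqrtr nl; have := sqrtr_ge0 (n%:R * ln n%:R : R).
  move: ks; set w := Num.sqrt _ => ks w0 wE.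
  have : w ^+ 2 <= (1 / 2 * (k n)%:R) ^+ 2.
    by rewrite lerXn2r ?nnegrE ?(ltW ks) // ltW // mulr_gt0.
  rewrite wE; lra.
Unshelve. all: by end_near. Qed.

Lemma aas_sparse_upper (C : R) : 3 + 7 / eps <= C ->
  much_less (fun n => (D n)^-1) p ->
  (\forall n \near \oo, p n <= r n `^ (1 - eps) * (D n)^-1) ->
  aas k p (fun n H => (max_intersecting H)%:R <= C * (N n / D n) * ln (p n * D n)).
Proof.
move=> hC hpD hpr; apply: aasP => // d d0; near=> n.
have [k0 kn] : (0 < k n)%N /\ (2 * k n <= n)%N by near: n.
have p01 : 0 < p n < 1 by near: n.
have D0 : 0 < D n by near: n.
have N0 : 0 < N n by near: n.
have y1 : expR 1 < p n * D n by near: n; exact: much_less_inv_gt.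
have y2 : d^-1 < p n * D n by near: n; exact: much_less_inv_gt.
have pr : p n <= r n `^ (1 - eps) * (D n)^-1 by near: n.
have y0 : 0 < p n * D n by apply: lt_trans y1; exact: expR_gt0.
have L1 : 1 <= ln (p n * D n) by rewrite -ler_expR lnK ?posrE // ltW.
have yr : p n * D n <= r n `^ (1 - eps) by rewrite -ler_pdivlMr.
apply: le_trans (_ : 1 - expR (- (ln (p n * D n)) ^+ 2) <= _).
  rewrite lerD2l lerN2; apply: (@le_trans _ _ (expR (- ln (p n * D n)))).
    rewrite ler_expR lerN2 expr2 ler_peMr //; lra.
  rewrite expRN lnK ?posrE // -[leRHS]invrK lef_pV2 ?posrE ?invr_gt0 //.
  exact: ltW.
apply: le_trans (upper_sparse k0 kn p01 heps L1 yr) _.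
apply: hyp_prob_mono; first by case/andP: p01 => ? ?; rewrite !ltW.
move=> H h; apply: le_trans h _; rewrite -!mulrA ler_wpM2r //.
by rewrite !mulr_ge0 ?invr_ge0 // (le_trans ler01 L1).
Unshelve. all: by end_near. Qed.

Lemma aas_dense (C : R) : (26 * (ln (8 / eps) + 1) / (eps ^+ 2 / 64)) ^+ 2 <= C ->
  (\forall n \near \oo, C * r n * ln (r n) ^+ 2 * (D n)^-1 <= p n) ->
  aas k p (fun n H =>
    approx_eq eps (max_intersecting H)%:R (p n * ((k n)%:R / n%:R) * N n)).
Proof.
have /andP[e0 e1] := heps.
move=> hC hpr; apply: aasP => // d d0.
pose mu n := p n * ((k n)%:R / n%:R) * N n.
have C0 : 0 < C.
  apply: lt_le_trans hC; rewrite exprn_gt0 // divr_gt0 ?divr_gt0 ?exprn_gt0 //.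
  rewrite mulr_gt0 // ltr_wpDl // ln_ge0 // ler_pdivlMr //; lra.
(* The hypothesis gives [mu >= C Q ln^2 r]. Either [ln r] is large, or [r] is bounded and
   [Q >= 1 + k^2 / n = 1 + n / r^2] is large. The 1 in [B] ensures [ln r >= 1], so that squaring
   does not shrink it. *)
have mu_oo (M : R) : 0 < M -> \forall n \near \oo, M <= mu n.
  move=> M0; pose B := M / C + 1; near=> n.
  have [k0 kn] : (0 < k n)%N /\ (2 * k n <= n)%N by near: n.
  have p01 : 0 < p n < 1 by near: n.
  have D0 : 0 < D n by near: n.
  have N0 : 0 < N n by near: n.
  have hpn : C * r n * ln (r n) ^+ 2 * (D n)^-1 <= p n by near: n.
  have nbig : 4 * (M / C) * expR B ^+ 2 <= n%:R by near: n; exact: near_ge_nat.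
  have n0 : 0 < n%:R :> R by rewrite ltr0n (leq_trans _ kn) // muln_gt0.
  have kR0 : 0 < (k n)%:R :> R by rewrite ltr0n.
  have r2 : 2 <= r n := ratio_ge2 k0 kn p01.
  have r0 : 0 < r n by lra.
  have l2 := ln_ge_half r2.
  have Q1 : 1 + (k n)%:R ^+ 2 / n%:R <= N n / D n := quot_ge k0 kn p01.
  have kn0 : 0 <= (k n)%:R ^+ 2 / n%:R :> R by rewrite divr_ge0 ?sqr_ge0.
  have Qge1 : 1 <= N n / D n by apply: le_trans Q1; rewrite lerDl.
  apply: (@le_trans _ _ (C * (ln (r n) ^+ 2 * (N n / D n)))); last first.
    have -> : C * (ln (r n) ^+ 2 * (N n / D n)) =
        (C * r n * ln (r n) ^+ 2 * (D n)^-1) * ((k n)%:R / n%:R * N n).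
      by rewrite /r; field; rewrite !gt_eqF.
    rewrite /mu -[leRHS]mulrA; apply: ler_wpM2r => //.
    by rewrite mulr_ge0 ?divr_ge0 ?(ltW N0).
  rewrite -ler_pdivrMl // mulrC.
  have MC0 : 0 < M / C by rewrite divr_gt0.
  have [rB|rB] := lerP (expR B) (r n).
    have lB : B <= ln (r n) by rewrite -ler_expR lnK ?posrE.
    have MB : M / C <= ln (r n) by apply: le_trans lB; rewrite lerDl.
    have l1 : 1 <= ln (r n) by apply: le_trans lB; rewrite lerDr ltW.
    rewrite -[leLHS]mulr1; apply: ler_pM => //; first exact: ltW.
    by rewrite expr2 (le_trans MB) // ler_peMr // (le_trans ler01).
  have knE : (k n)%:R ^+ 2 / n%:R = n%:R / r n ^+ 2 by rewrite /r; field; rewrite !gt_eqF.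
  have h1 : 4 * (M / C) <= n%:R / r n ^+ 2.
    rewrite ler_pdivlMr ?exprn_gt0 //; apply: le_trans nbig.
    apply: ler_wpM2l; first by rewrite mulr_ge0 // ltW.
    by rewrite lerXn2r ?nnegrE ?expR_ge0 ?(ltW r0) // ltW.
  have h2 : 1 / 4 <= ln (r n) ^+ 2 by nra.
  have -> : M / C = 1 / 4 * (4 * (M / C)) by field; rewrite gt_eqF.
  apply: ler_pM => //; first by rewrite mulr_ge0 // ltW.
  by apply: le_trans h1 _; apply: le_trans Q1; rewrite -knE lerDr.
pose c := eps ^+ 2 / 64; have c0 : 0 < c by rewrite divr_gt0 ?exprn_gt0.
have m2_gt0 : 0 < 2 / c * (2 / d) by apply: mulr_gt0; exact: divr_gt0.
near=> n.
have [k0 kn] : (0 < k n)%N /\ (2 * k n <= n)%N by near: n.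
have p01 : 0 < p n < 1 by near: n.
have hpn : C * r n * ln (r n) ^+ 2 * (D n)^-1 <= p n by near: n.
have m1 : 2 / (eps ^+ 2 * d) <= mu n.
  by near: n; apply: mu_oo; rewrite divr_gt0 ?mulr_gt0 ?exprn_gt0.
have m2 : 2 / c * (2 / d) <= mu n by near: n; apply: mu_oo; exact: m2_gt0.
have mu0 : 0 < mu n by apply: lt_le_trans m2; exact: m2_gt0.
have lo := lower_star k0 kn p01 e0.
have up : 1 - expR (- (c / 2 * mu n)) <= hyp_prob (k n) (p n)
   (fun H : hypergraph n => (max_intersecting H)%:R <= (1 + eps) * mu n).
  apply: upper_dense => //; apply: le_trans hpn.
  rewrite ler_wpM2r ?invr_ge0 // ler_wpM2r ?sqr_ge0 // ler_wpM2r // divr_ge0 //.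
have p01' : 0 <= p n <= 1 by case/andP: p01 => ? ?; rewrite !ltW.
apply: le_trans (hyp_prob_and (k n) _ _ p01'); rewrite -/(mu n).
have e1' : (eps ^+ 2 * mu n)^-1 <= d / 2.
  rewrite -[leLHS]mul1r ler_pdivrMr; last by rewrite mulr_gt0 // exprn_gt0.
  move: m1; rewrite ler_pdivrMr; last by rewrite mulr_gt0 // exprn_gt0.
  by move: (mu n) => m h; lra.
have e2' : expR (- (c / 2 * mu n)) <= d / 2.
  rewrite expRN -[leRHS]invrK lef_pV2 ?posrE ?invr_gt0 ?divr_gt0 ?expR_gt0 //.
  rewrite invf_div; apply: (@le_trans _ _ (1 + c / 2 * mu n)); last exact: expR_ge1Dx.
  have := ler_wpM2l (_ : 0 <= c / 2) m2; rewrite divr_ge0 ?(ltW c0) // => /(_ isT).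
  have -> : c / 2 * (2 / c * (2 / d)) = 2 / d by field; rewrite !gt_eqF.
  lra.
move: lo up; rewrite -/(mu n) => lo up; lra.
Unshelve. all: by end_near. Qed.

End Asymptotics.

Theorem theorem1p2 (R : realType) (eps : R) (heps : 0 < eps < 1) :
  exists2 C : R, 0 < C &
  forall (p : nat -> R) (k : nat -> nat),
    (\forall n \near \oo, 0 < p n < 1) ->
    (\forall n \near \oo, (2 <= k n)%N /\ ((k n)%:R : R) <= n%:R / 2) ->
    let N : nat -> R := fun n => ('C(n, k n))%:R in
    let D : nat -> R := fun n => ('C(n - k n, k n))%:R in
    let r : nat -> R := fun n => n%:R / (k n)%:R in
    [/\ much_less (fun n => (N n)^-1) p ->
        much_less p (fun n => (D n)^-1) ->
        aas k p (fun n H =>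
          approx_eq eps (max_intersecting H)%:R (p n * N n)),
        much_less (fun n => (D n)^-1) p ->
        (\forall n \near \oo, p n <= r n * (D n)^-1) ->
        much_less (fun n => Num.sqrt (n%:R * ln n%:R) : R)
          (fun n => (k n)%:R : R) ->
        aas k p (fun n H =>
          (1 - eps) * (N n / D n) * ln (p n * D n)
            <= (max_intersecting H)%:R),
        much_less (fun n => (D n)^-1) p ->
        (\forall n \near \oo, p n <= r n `^ (1 - eps) * (D n)^-1) ->
        aas k p (fun n H =>
          (max_intersecting H)%:R <= C * (N n / D n) * ln (p n * D n))
      & (\forall n \near \oo, C * r n * ln (r n) ^+ 2 * (D n)^-1 <= p n) ->
        aas k p (fun n H =>
          approx_eq eps (max_intersecting H)%:R
            (p n * ((k n)%:R / n%:R) * N n)) ].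
Proof.
have /andP[e0 e1] := heps.
(* A larger [C] weakens the bound in (3) and strengthens the hypothesis of (4), so the sum of the
   two constants serves both. *)
pose C1 : R := 3 + 7 / eps.
pose C2 : R := (26 * (ln (8 / eps) + 1) / (eps ^+ 2 / 64)) ^+ 2.
have C1_gt0 : 0 < C1 by rewrite ltr_pwDl // divr_ge0 // ltW.
have C2_ge0 : 0 <= C2 by exact: sqr_ge0.
exists (C1 + C2); first by rewrite ltr_pwDl.
move=> p k hp hk N D r; split.
- exact: aas_very_sparse.
- exact: aas_sparse_lower.
- by apply: aas_sparse_upper => //; rewrite lerDl.
- by apply: aas_dense => //; rewrite lerDr ltW.
Qed.
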